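(* Let $g\in L^2(\mathbb R)$ and $a,b>0$, and suppose that $(g,a,b)$ is a WH-frame with frame bounds $A,B$. Let $h\in L^2(\mathbb R)$, and assume there exists $R$ with $0\le R<A$ such that $$\|g-h\|_{W,a}\le \sqrt{\frac{bR}{4}}.$$ Then $(h,a,b)$ is a WH-frame with frame bounds $A\left(1-\sqrt{\frac{R}{A}}\right)^2$ (lower) and $B\left(1+\sqrt{\frac{R}{B}}\right)^2$ (upper). Moreover, if $(g,a,b)$ is a Riesz basis for $L^2(\mathbb R)$, then $(h,a,b)$ is also a Riesz basis for $L^2(\mathbb R)$.
   Context: A sequence $(f_n)_{n\in I}$ in a Hilbert space $H$ is a frame for $H$ with frame bounds $A,B$ (lower bound $A$, upper bound $B$) if $A,B>0$ and $A\|f\|^2\le\sum_{n\in I}|\langle f,f_n\rangle|^2\le B\|f\|^2$ for all $f\in H$ (the bounds need not be optimal). It is a Riesz basis for $H$ if it is a bounded unconditional basis for $H$. For $g\in L^2(\mathbb R)$ (complex-valued), $a,b>0$ and $m,n\in\mathbb Z$, put $E_{mb}g(t)=e^{2\pi i mbt}g(t)$ and $T_{na}g(t)=g(t-na)$. The triple $(g,a,b)$ is called a Weyl-Heisenberg frame (WH-frame) for $L^2(\mathbb R)$ if $(E_{mb}T_{na}g)_{m,n\in\mathbb Z}$ is a frame for $L^2(\mathbb R)$; its frame bounds are those of this sequence. Likewise $(g,a,b)$ is a Riesz basis if this sequence is. For $f\in L^2(\mathbb R)$ and $a>0$, $\|f\|_{W,a}:=\sum_{n\in\mathbb Z}\|T_{na}f\cdot\chi_{[0,a)}\|_\infty\in[0,\infty]$,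 where $\|\cdot\|_\infty$ is the essential supremum norm. *)

(* Defs.v *)
From HB Require Import structures.
From mathcomp Require Import all_boot all_order all_algebra.
From mathcomp Require Import complex.
From mathcomp Require Import all_classical all_reals all_analysis.

Set Implicit Arguments.
Unset Strict Implicit.
Unset Printing Implicit Defensive.

Import Order.TTheory GRing.Theory Num.Theory.
Import numFieldNormedType.Exports.

Local Open Scope classical_set_scope.
Local Open Scope ring_scope.

(** Elements of L^2(R) are handled through representatives [f : R -> R[i]];
    every notion below is invariant under almost-everywhere equality. *)

Section ComplexL2.
Context {R : realType}.
Local Notation mu := (@lebesgue_measure R).

Definition cLnorm (p : \bar R) (f : R -> R[i]) : \bar R :=
  Lnorm mu p (fun t => (Normc.normc (f t))%:E).

Definition L2 (f : R -> R[i]) : Prop :=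
  [/\ measurable_fun [set: R] (fun t => complex.Re (f t)),
      measurable_fun [set: R] (fun t => complex.Im (f t)) &
      (cLnorm 2%:E f < +oo)%E].

(** [<f, g> = \int f(t) * conj (g(t)) dt], computed componentwise. *)
Definition inner (f g : R -> R[i]) : R[i] :=
  Complex (Rintegral mu [set: R] (fun t => complex.Re (f t * conjc (g t))))
          (Rintegral mu [set: R] (fun t => complex.Im (f t * conjc (g t)))).

Definition is_frame (I : choiceType) (e : I -> R -> R[i]) (A B : R) : Prop :=
  [/\ forall i, L2 (e i), 0 < A, 0 < B &
      forall f, L2 f ->
        (A%:E * cLnorm 2%:E f ^+ 2
           <= \esum_(i in [set: I]) (Normc.normc (inner f (e i)) ^+ 2)%:E
           <= B%:E * cLnorm 2%:E f ^+ 2)%E].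

Definition expansion (e : nat -> R -> R[i]) (c : nat -> R[i])
    (f : R -> R[i]) : Prop :=
  (fun N : nat =>
     cLnorm 2%:E (fun t => f t - \sum_(k < N) c k * e k t)) @ \oo --> 0%E.

(** A family indexed by [Z * Z] has no preferred order. [c] is a coefficient
    family whose series converges to [f] along every enumeration of the index
    set, and no other family represents [f] along any enumeration. *)
Definition unconditional_basis (e : int * int -> R -> R[i]) : Prop :=
  (forall i, L2 (e i)) /\
  forall f, L2 f -> exists c : int * int -> R[i],
    (forall s : nat -> int * int, bijective s ->
       expansion (e \o s) (c \o s) f) /\
    (forall (s : nat -> int * int) (c' : int * int -> R[i]), bijective s ->
       expansion (e \o s) (c' \o s) f -> c' =1 c).

(** Bounded means norms bounded above and bounded away from zero. *)
Definition bounded_family (e : int * int -> R -> R[i]) : Prop :=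
  exists m M : R, 0 < m /\
    forall i, (m%:E <= cLnorm 2%:E (e i) <= M%:E)%E.

Definition is_riesz_basis (e : int * int -> R -> R[i]) : Prop :=
  unconditional_basis e /\ bounded_family e.

Definition modulate (c : R) (g : R -> R[i]) : R -> R[i] :=
  fun t => Complex (cos (2 * pi * c * t)) (sin (2 * pi * c * t)) * g t.

Definition translate (c : R) (g : R -> R[i]) : R -> R[i] :=
  fun t => g (t - c).

Definition WH_system (g : R -> R[i]) (a b : R) (mn : int * int) : R -> R[i] :=
  modulate (mn.1%:~R * b) (translate (mn.2%:~R * a) g).

Definition is_WH_frame (g : R -> R[i]) (a b A B : R) : Prop :=
  is_frame (WH_system g a b) A B.

Definition is_WH_riesz_basis (g : R -> R[i]) (a b : R) : Prop :=
  is_riesz_basis (WH_system g a b).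

Definition wiener_norm (a : R) (f : R -> R[i]) : \bar R :=
  \esum_(n in [set: int])
    cLnorm +oo%E
      (fun t => translate (n%:~R * a) f t * ((\1_(`[0, a[ : set R) t : R)%:C)%C).

End ComplexL2.

(* Main.v *)
Require Import Defs.
From mathcomp Require Import all_boot all_order all_algebra.
From mathcomp Require Import complex.
From mathcomp Require Import all_classical all_reals all_analysis.
From mathcomp Require Import measurable_realfun ess_sup_inf ring lra.

Set Implicit Arguments.
Unset Strict Implicit.
Unset Printing Implicit Defensive.

Import Order.TTheory GRing.Theory Num.Theory.
Import numFieldNormedType.Exports.

Local Open Scope classical_set_scope.
Local Open Scope ring_scope.

(** Write [phi = g - h], [e_mn = E_{mb} T_{na} g], and say that a system is
    Bessel with bound [B] when it satisfies the upper frame inequality. All the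
    conclusions follow from one estimate: the system generated by [phi] is Bessel
    with bound [r].

    That estimate is [gabor_bessel_wiener]: if [a * b <= 1] and [v] has Wiener
    norm at most [W], then [(v, a, b)] is Bessel with bound [W ^ 2 / b]. For fixed
    [n] the sum of the [|<f, E_{mb} T_{na} v>|^2] over [m] is the product of [f]
    with [p T_{na} v], where [p] is the trigonometric polynomial whose coefficients
    are the [<f, E_{mb} T_{na} v>]. On the translated cell [ [(j + n) a, (j + n + 1) a[ ]
    the function [T_{na} v] is bounded by a constant [c_j], the sum of the [c_j]
    being at most [W]; and as a cell is not longer than the period [1 / b] of [p],
    Parseval's identity bounds the energy of [p] there. Young's inequality, with
    weight [W / b], absorbs the energy of [p], and summing over [j] and [n] only
    leaves the norm of [f].

    The condition [a * b <= 1] is the density theorem [gabor_density]. Testing the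
    lower frame inequality on indicators of intervals of length at most [1 / b] gives
    [A a b <= |g|^2 <= B] for every frame ([gabor_redundancy]), so it suffices to
    find frames with the same [a] and [b] whose bounds are nearly equal. If [S] is
    the frame operator, scaled so that [1 - d <= S <= 1], then [(3 g - S g) / 2]
    generates a frame with bounds [1 - d ^ 2] and [1] ([gabor_improve]), because
    [S] commutes with time-frequency shifts; iterating makes [d] tend to [0].

    The frame bounds of [(h, a, b)] then come from the triangle inequality for the
    analysis operators ([bessel_perturb], [frame_below_perturb]).

    For Riesz bases the point is that finite sums satisfy
    [A * sum |c_k|^2 <= |sum c_k e_k|^2] when the frame [e] is a basis
    ([riesz_lower_bound]). The Bessel estimate for [phi] transfers such a lower
    bound to the system of [h] ([lower_bound_perturb]). A frame with a lower bound
    on finite sums is a basis ([basis_of_lower_bound]): expansions exist by frame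
    theory, converge along every enumeration, and are unique by the lower bound.

    Frame theory is expressed with quadratic forms: the form [D u v] stands for
    [Re <S u, v>], and [S] is inverted by minimising a quadratic functional
    ([lax_milgram]), which rests on the completeness of [L^2] ([complete_ip]). *)

(** * Positive semidefinite forms *)

Section Forms.
Context {R : realType} {V : lmodType R}.

Record psd_form (D : V -> V -> R) : Prop := PsdForm {
  psdC : forall x y, D x y = D y x;
  psdDl : forall x y z, D (x + y) z = D x z + D y z;
  psdZl : forall c x y, D (c *: x) y = c * D x y;
  psd_ge0 : forall x, 0 <= D x x }.

Section FormTheory.
Context {D : V -> V -> R} (fD : psd_form D).

Lemma psdDr x y z : D x (y + z) = D x y + D x z.
Proof. by rewrite !(psdC fD x) (psdDl fD). Qed.

Lemma psdZr c x y : D x (c *: y) = c * D x y.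
Proof. by rewrite !(psdC fD x) (psdZl fD). Qed.

Lemma psdNl x y : D (- x) y = - D x y.
Proof. by rewrite -scaleN1r (psdZl fD) mulN1r. Qed.

Lemma psdNr x y : D x (- y) = - D x y.
Proof. by rewrite psdC// psdNl psdC. Qed.

Lemma psd_suml (I : Type) (s : seq I) (F : I -> V) y :
  D (\sum_(i <- s) F i) y = \sum_(i <- s) D (F i) y.
Proof.
elim: s => [|i s ih]; last by rewrite !big_cons psdDl// ih.
by rewrite !big_nil -(scale0r 0) psdZl// mul0r.
Qed.

Lemma psd0l y : D 0 y = 0.
Proof. by rewrite -(scale0r 0) psdZl// mul0r. Qed.

Lemma psd_sqD x y : D (x + y) (x + y) = D x x + 2 * D x y + D y y.
Proof. by rewrite psdDl// !psdDr (psdC fD y x); ring. Qed.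

Lemma psd_sqB x y : D (x - y) (x - y) = D x x - 2 * D x y + D y y.
Proof. by rewrite psd_sqD psdNr psdNl psdNr; ring. Qed.

(** The square of [t x - y] is nonnegative: this weighted form of the
    Cauchy-Schwarz inequality needs no square roots. *)
Lemma psd_young t x y : 0 < t -> 2 * D x y <= t * D x x + t^-1 * D y y.
Proof.
move=> t0; have := psd_ge0 fD (t *: x - y).
rewrite psd_sqB !psdZl// psdZr => h.
have {h} : 0 <= t^-1 * (t * (t * D x x) - 2 * (t * D x y) + D y y).
  by rewrite mulr_ge0// invr_ge0 ltW.
rewrite (_ : t^-1 * _ = (t * D x x + t^-1 * D y y) - 2 * D x y) ?subr_ge0//.
by field; rewrite gt_eqF.
Qed.

Lemma psd_sqB_le2 x y : D (x - y) (x - y) <= 2 * (D x x + D y y).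
Proof.
have := psd_young x (- y) ltr01; rewrite invr1 !mul1r psd_sqB.
by rewrite psdNr psdNl psdNr; lra.
Qed.

End FormTheory.

Lemma psd_formB D E : psd_form D -> psd_form E ->
  (forall x, E x x <= D x x) -> psd_form (fun x y => D x y - E x y).
Proof.
move=> fD fE ED; split => [x y|x y z|c x y|x].
- by rewrite (psdC fD) (psdC fE).
- by rewrite (psdDl fD) (psdDl fE); ring.
- by rewrite (psdZl fD) (psdZl fE); ring.
- by rewrite subr_ge0.
Qed.

Lemma psd_form_sum (I : Type) (s : seq I) (F : I -> V -> V -> R) :
  (forall i, psd_form (F i)) -> psd_form (fun x y => \sum_(i <- s) F i x y).
Proof.
move=> fF; split => [x y|x y z|c x y|x].
- by apply: eq_bigr => i _; rewrite (psdC (fF i)).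
- by rewrite -big_split; apply: eq_bigr => i _; rewrite (psdDl (fF i)).
- by rewrite mulr_sumr; apply: eq_bigr => i _; rewrite (psdZl (fF i)).
- by apply: sumr_ge0 => i _; exact: psd_ge0.
Qed.

Definition polar (Q : V -> R) x y : R := 4^-1 * (Q (x + y) - Q (x - y)).

Lemma cvg_polar (F : nat -> V -> V -> R) (Q : V -> R) :
  (forall N, psd_form (F N)) ->
  (forall x, (F N x x) @[N --> \oo] --> Q x) ->
  forall x y, (F N x y) @[N --> \oo] --> polar Q x y.
Proof.
move=> fF FQ x y.
rewrite (_ : (fun N => F N x y) = (fun N => polar (fun z => F N z z) x y)); last first.
  apply/funext => N; rewrite /polar (psd_sqD (fF N)) (psd_sqB (fF N)).
  by field.
by apply: cvgMl_tmp; apply: cvgB; exact: FQ.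
Qed.

(** Bilinearity passes to pointwise limits, so a limit of quadratic forms is the
    quadratic form of its polarisation. *)
Lemma polar_psd_form (F : nat -> V -> V -> R) (Q : V -> R) :
  (forall N, psd_form (F N)) ->
  (forall x, (F N x x) @[N --> \oo] --> Q x) ->
  psd_form (polar Q) /\ (forall x, polar Q x x = Q x).
Proof.
move=> fF FQ; have cF := cvg_polar fF FQ.
have diag x : polar Q x x = Q x.
  exact: cvg_unique (cF x x) (FQ x).
have lim (u : nat -> R) (l : R) x y : u = (fun N => F N x y) ->
    u N @[N --> \oo] --> l -> polar Q x y = l.
  by move=> -> h; exact: cvg_unique (cF x y) h.
split => //; split => [x y|x y z|c x y|x].
- apply: (lim (fun N => F N y x)) => //.
  by apply/funext => N; exact: psdC.
- apply: (lim (fun N => F N x z + F N y z)) => //; last exact: cvgD.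
  by apply/funext => N; rewrite psdDl.
- apply: (lim (fun N => c * F N x y)) => //; last exact: cvgMl_tmp.
  by apply/funext => N; rewrite psdZl.
- rewrite diag; apply: cvgr_to_ge (FQ x) _.
  by apply: nearW => N; exact: psd_ge0.
Qed.

End Forms.

(** * Solving equations with coercive forms *)

Section Hilbert.
Context {R : realType} {V : lmodType R}.

(** Convergence of fast Cauchy sequences is all that minimisation needs. Limits
    are only determined up to vectors of seminorm [0], as forms may be degenerate. *)
Definition complete_form (ip : V -> V -> R) : Prop :=
  forall u : nat -> V,
    (forall n, ip (u n.+1 - u n) (u n.+1 - u n) <= (4^-1) ^+ n) ->
    exists l, (ip (u n - l) (u n - l)) @[n --> \oo] --> 0.

Context {ip : V -> V -> R} (fip : psd_form ip).

(** Lax-Milgram, symmetric case: [u] minimises [D x x - 2 * E f x], and the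
    coercivity of [D] makes a minimising sequence Cauchy. *)
Lemma lax_milgram (cip : complete_form ip) (D E : V -> V -> R) (A B C : R) :
  psd_form D -> psd_form E -> 0 < A -> 0 < C ->
  (forall x, A * ip x x <= D x x) -> (forall x, D x x <= B * ip x x) ->
  (forall x, E x x <= C * ip x x) ->
  forall f, exists u, forall y, D u y = E f y.
Proof.
move=> fD fE A0 C0 AD DB EC f.
pose J x := D x x - 2 * E f x.
have Jlb x : - (C / A * E f f) <= J x.
  have t0 : 0 < C / A by rewrite divr_gt0.
  have h := psd_young fE f x t0.
  have : (C / A)^-1 * E x x <= A * ip x x.
    rewrite invf_div mulrAC ler_pdivrMr// -mulrA ler_pM2l// mulrC.
    by rewrite EC.
  by have := AD x; rewrite /J; lra.
pose S := [set J x | x in setT].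
have hS : has_inf S.
  split; first by exists (J 0); exists 0.
  by exists (- (C / A * E f f)) => _ [x _ <-]; exact: Jlb.
have mJ x : inf S <= J x.
  by apply: inf_lbound; [case: hS|exists x].
(* the factor [A / 4] turns the coercivity estimate for two successive almost
   minimisers into the rate [4^-1 ^+ n] of [complete_form] *)
pose eps n := A / 4 * (4^-1) ^+ n.
have eps0 n : 0 < eps n by rewrite !mulr_gt0 ?invr_gt0 ?exprn_gt0 ?invr_gt0.
have /choice[x xP] : forall n, exists x, J x < inf S + eps n.
  move=> n; have [_ [x _ <-] h] := inf_adherent (eps0 n) hS.
  by exists x.
have par a c : D (a - c) (a - c) = 2 * J a + 2 * J c - 4 * J (2^-1 *: (a + c)).
  rewrite /J (psdZl fD) (psdZr fD) (psdZr fE) (psd_sqB fD) (psd_sqD fD).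
  by rewrite (psdDr fE); field.
have xC n : ip (x n.+1 - x n) (x n.+1 - x n) <= (4^-1) ^+ n.
  rewrite -(ler_pM2l A0) (le_trans (AD _))// par.
  have := mJ (2^-1 *: (x n.+1 + x n)); have := xP n; have := xP n.+1.
  have : eps n.+1 <= eps n.
    rewrite /eps ler_pM2l ?divr_gt0// exprS ler_piMl ?exprn_ge0 ?invr_ge0//.
    by rewrite invf_le1// ler1n.
  have : 4 * eps n = A * (4^-1) ^+ n by rewrite /eps; field.
  by lra.
have [u xu] := cip x xC.
exists u => y; apply/eqP; rewrite -subr_eq0; set al := _ - _.
pose be := D y y.
have be0 : 0 <= be by exact: psd_ge0.
(* first order condition: [J] cannot decrease along the line [u + t *: y] *)
have key t : 0 <= 2 * t * al + 2 * t ^+ 2 * be.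
  have lim0 : (- eps n - B * ip (x n - u) (x n - u)) @[n --> \oo] --> (0 : R).
    rewrite (_ : 0 = - (A / 4 * 0) - B * 0); last by ring.
    apply: cvgB; last exact: cvgMl_tmp.
    apply: cvgN; apply: cvgMl_tmp; apply: cvg_expr.
    by rewrite ger0_norm ?invr_ge0// invf_lt1// ltr1n.
  apply: cvgr_to_le lim0 _; apply: nearW => n.
  have := mJ (x n + t *: y); have := xP n.
  rewrite /J (psd_sqD fD) !(psdZr fD) (psdZl fD) (psdDr fE) (psdZr fE).
  have := DB (x n - u); have := psd_ge0 fD ((x n - u) - t *: y).
  have e : D (x n - u) y = D (x n) y - D u y by rewrite psdDl// psdNl.
  rewrite (psd_sqB fD) !(psdZr fD) (psdZl fD) e /al -/be.
  by move: (D (x n - u) (x n - u)) => Dw; lra.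
have s0 : 0 < (be + 1)^-1 by rewrite invr_gt0 ltr_wpDl.
have be1 : be + 1 != 0 by rewrite gt_eqF// ltr_wpDl.
have := key (- al * (be + 1)^-1).
have -> : 2 * (- al * (be + 1)^-1) * al + 2 * (- al * (be + 1)^-1) ^+ 2 * be =
    - (2 * al ^+ 2 * (be + 1)^-1 ^+ 2) by field.
rewrite oppr_ge0 pmulr_lle0 ?exprn_gt0// pmulr_rle0// => h.
by rewrite -sqrf_eq0 eq_le h sqr_ge0.
Qed.

(** For [y := f - s N] one has [ip y y = (D - F N) u y]. As [D - F N] is positive
    and at most [B * ip], Young's inequality absorbs the part in [y] and leaves
    [ip y y <= B * (D - F N) u u], which tends to [0]. *)
Lemma cvg_reconstruction (D : V -> V -> R) (F : nat -> V -> V -> R) (B : R)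
    (f u : V) (s : nat -> V) :
  psd_form D -> (forall N, psd_form (F N)) -> 0 < B ->
  (forall N x, F N x x <= D x x) -> (forall x, D x x <= B * ip x x) ->
  (F N u u) @[N --> \oo] --> D u u ->
  (forall y, D u y = ip f y) -> (forall N y, F N u y = ip (s N) y) ->
  ip (f - s N) (f - s N) @[N --> \oo] --> 0.
Proof.
move=> fD fF B0 FD DB Fu Du Fs.
have fB N : psd_form (fun x y => D x y - F N x y) by exact: psd_formB.
have bd N : ip (f - s N) (f - s N) <= B * (D u u - F N u u).
  set y := f - s N.
  have e : ip y y = D u y - F N u y by rewrite Du Fs {1}/y psdDl// psdNl.
  have := psd_young (fB N) u y B0; rewrite -e => h.
  have : B^-1 * (D y y - F N y y) <= ip y y.
    rewrite mulrC ler_pdivrMr// mulrC (le_trans _ (DB y))// gerBl.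
    exact: psd_ge0.
  by lra.
apply: (@squeeze_cvgr _ _ _ _ (fun=> 0) (fun N => B * (D u u - F N u u))).
- by apply: nearW => N; rewrite psd_ge0//= bd.
- exact: cvg_cst.
- rewrite (_ : 0 = B * (D u u - D u u)); last by ring.
  by apply: cvgMl_tmp; apply: cvgB => //; exact: cvg_cst.
Qed.

End Hilbert.

(** * Square integrable complex functions *)

Notation cRe := (@complex.Re _).
Notation cIm := (@complex.Im _).

Section ComplexArith.
Context {R : rcfType}.
Implicit Types x y : R[i].

Lemma cReM x y : cRe (x * y) = cRe x * cRe y - cIm x * cIm y.
Proof. by case: x y => [a b] [c d]. Qed.

Lemma cImM x y : cIm (x * y) = cRe x * cIm y + cIm x * cRe y.
Proof. by case: x y => [a b] [c d]. Qed.

Lemma normc_sq x : Normc.normc x ^+ 2 = cRe x ^+ 2 + cIm x ^+ 2.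
Proof. by case: x => a b; rewrite sqr_sqrtr// addr_ge0// sqr_ge0. Qed.

Lemma complex_ext x y : cRe x = cRe y -> cIm x = cIm y -> x = y.
Proof. by case: x y => [a b] [c d] /= -> ->. Qed.

End ComplexArith.

Section L2Functions.
Context {R : realType}.
Local Notation mu := (@lebesgue_measure R).
Implicit Types f g : R -> R[i].

Lemma Lfun2P (h : R -> R) : h \in Lfun mu 2%:E <->
  measurable_fun setT h /\ (\int[mu]_t (h t ^+ 2)%:E < +oo)%E.
Proof.
have e : (\int[mu]_t `| (EFin \o h) t | `^ 2 = \int[mu]_t (h t ^+ 2)%:E)%E.
  apply: eq_integral => t _ /=.
  by rewrite powR_mulrn// real_normK// num_real.
split.
  move=> Lh; split; first by case/andP: Lh => /[!inE].
  exact: integrable_lty measurableT _ (Lfun2_integrable_sqr Lh).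
move=> [mh ih]; apply/andP; rewrite !inE /=; split => //.
rewrite /finite_norm; apply: (@lty_poweRy _ _ 2); first by [].
by rewrite poweR_Lnorm// e.
Qed.

Definition sqmod f t : R := cRe (f t) ^+ 2 + cIm (f t) ^+ 2.

Lemma sqmod_ge0 f t : 0 <= sqmod f t.
Proof. by rewrite addr_ge0// sqr_ge0. Qed.

Lemma cLnorm2_poweR f : (cLnorm 2%:E f `^ 2 = \int[mu]_t (sqmod f t)%:E)%E.
Proof.
rewrite poweR_Lnorm//; apply: eq_integral => t _ /=.
rewrite powR_mulrn// real_normK ?num_real// normc_sq.
by [].
Qed.

Lemma cLnorm_ge0 p f : (0 <= cLnorm p f)%E.
Proof. exact: Lnorm_ge0. Qed.

Lemma L2E f : L2 f <-> [/\ measurable_fun setT (cRe \o f),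
  measurable_fun setT (cIm \o f) & (\int[mu]_t (sqmod f t)%:E < +oo)%E].
Proof.
split=> -[mr mi h]; split => //.
  by rewrite -cLnorm2_poweR poweR_lty.
by apply: (@lty_poweRy _ _ 2); rewrite // cLnorm2_poweR.
Qed.

Lemma measurable_sqmod f : measurable_fun setT (cRe \o f) ->
  measurable_fun setT (cIm \o f) -> measurable_fun setT (sqmod f).
Proof.
move=> mr mi; apply: (@measurable_funD _ _ _ _ (fun t => cRe (f t) ^+ 2)).
  exact: (measurable_funX 2 mr).
exact: (measurable_funX 2 mi).
Qed.

Lemma L2_Lfun f :
  L2 f <-> (cRe \o f \in Lfun mu 2%:E) /\ (cIm \o f \in Lfun mu 2%:E).
Proof.
rewrite L2E !Lfun2P; split=> [[mr mi h]|[[mr hr] [mi hi]]].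
  have m1 : measurable_fun setT (fun t => (cRe (f t) ^+ 2)%:E).
    by apply/measurable_EFinP; exact: (measurable_funX 2 mr).
  have m2 : measurable_fun setT (fun t => (cIm (f t) ^+ 2)%:E).
    by apply/measurable_EFinP; exact: (measurable_funX 2 mi).
  have m3 : measurable_fun setT (fun t => (sqmod f t)%:E).
    by apply/measurable_EFinP; exact: measurable_sqmod.
  split; split => //; apply: le_lt_trans h; apply: ge0_le_integral => //.
  - by move=> t _; rewrite lee_fin sqr_ge0.
  - by move=> t _; rewrite lee_fin lerDl sqr_ge0.
  - by move=> t _; rewrite lee_fin sqr_ge0.
  - by move=> t _; rewrite lee_fin lerDr sqr_ge0.
split => //; under eq_integral do rewrite EFinD.
rewrite ge0_integralD//.
- by rewrite lte_add_pinfty.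
- by move=> t _; rewrite lee_fin sqr_ge0.
- by apply/measurable_EFinP; exact: (measurable_funX 2 mr).
- by move=> t _; rewrite lee_fin sqr_ge0.
- by apply/measurable_EFinP; exact: (measurable_funX 2 mi).
Qed.

(** The real part of the Hermitian product. *)
Definition ipf f g : R :=
  Rintegral mu setT (fun t => cRe (f t) * cRe (g t) + cIm (f t) * cIm (g t)).

Lemma ipfE f g : cRe (inner f g) = ipf f g.
Proof.
apply: eq_Rintegral => t _; rewrite cReM.
by case: (f t) (g t) => [a b] [c d] /=; ring.
Qed.

Lemma Im_innerE f g : cIm (inner f g) = ipf f (fun t => 'i * g t)%C.
Proof.
apply: eq_Rintegral => t _; rewrite cImM cReM cImM.
by case: (f t) (g t) => [a b] [c d] /=; ring.
Qed.

Lemma ipf_integrable f g : L2 f -> L2 g -> mu.-integrable setT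
  (fun t => (cRe (f t) * cRe (g t) + cIm (f t) * cIm (g t))%:E).
Proof.
move=> /L2_Lfun[f1 f2] /L2_Lfun[g1 g2].
have /Lfun1_integrable h1 := Lfun2_mul_Lfun1 f1 g1.
have /Lfun1_integrable h2 := Lfun2_mul_Lfun1 f2 g2.
by have := integrableD measurableT h1 h2.
Qed.

Lemma int_sqmod f : L2 f -> (\int[mu]_t (sqmod f t)%:E)%E = (ipf f f)%:E.
Proof.
move=> Lf; rewrite /ipf /Rintegral fineK; last first.
  by rewrite integrable_fin_num// ipf_integrable.
by apply: eq_integral => t _; rewrite /sqmod !expr2.
Qed.

Lemma ipf_ge0 f : 0 <= ipf f f.
Proof.
by apply: Rintegral_ge0 => t _; rewrite -!expr2 addr_ge0// sqr_ge0.
Qed.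

Lemma cLnorm2E f : L2 f -> cLnorm 2%:E f = (Num.sqrt (ipf f f))%:E.
Proof.
move=> Lf; have h := cLnorm2_poweR f; rewrite int_sqmod// in h.
rewrite -[LHS]poweRe1 ?cLnorm_ge0//.
rewrite [X in (_ `^ X)%E](_ : 1 = 2 * 2^-1); last by rewrite mulfV.
rewrite poweRrM h.
by rewrite poweR_EFin powR12_sqrt// ipf_ge0.
Qed.

Lemma cLnorm2_sq f : L2 f -> (cLnorm 2%:E f ^+ 2)%E = (ipf f f)%:E.
Proof.
by move=> Lf; rewrite cLnorm2E// -EFin_expe sqr_sqrtr// ipf_ge0.
Qed.

End L2Functions.

(** * The real Hilbert space of square integrable functions *)

Section L2Space.
Context {R : realType}.
Local Notation mu := (@lebesgue_measure R).

Lemma one_le2 : (1 <= 2%:E :> \bar R)%E.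
Proof. by rewrite lee_fin ler1n. Qed.

(** [L^2(R)] as a real vector space, by real and imaginary parts; the complex
    structure is the operator [mulJ] below. Functions are not identified almost
    everywhere: the product [ip] is only semidefinite. *)
Definition L2V : lmodType R :=
  (LfunType mu one_le2 * LfunType mu one_le2)%type.

Definition cfun (v : L2V) : R -> R[i] := fun t => Complex (v.1 t) (v.2 t).

Let LfunD (f g : LfunType mu one_le2) t : (f + g) t = f t + g t.
Proof. by []. Qed.
Let LfunZ c (f : LfunType mu one_le2) t : (c *: f) t = c * f t.
Proof. by []. Qed.
Lemma L2V1D (u v : L2V) t : (u + v).1 t = u.1 t + v.1 t.
Proof. exact: LfunD. Qed.
Lemma L2V2D (u v : L2V) t : (u + v).2 t = u.2 t + v.2 t.
Proof. exact: LfunD. Qed.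
Lemma L2V1Z c (u : L2V) t : (c *: u).1 t = c * u.1 t.
Proof. exact: LfunZ. Qed.
Lemma L2V2Z c (u : L2V) t : (c *: u).2 t = c * u.2 t.
Proof. exact: LfunZ. Qed.
Definition L2VE := (L2V1D, L2V2D, L2V1Z, L2V2Z).

Lemma cRe_cfun v t : cRe (cfun v t) = v.1 t. Proof. by []. Qed.
Lemma cIm_cfun v t : cIm (cfun v t) = v.2 t. Proof. by []. Qed.

Lemma cReD (x y : R[i]) : cRe (x + y) = cRe x + cRe y.
Proof. by case: x y => [a b] [c d]. Qed.
Lemma cImD (x y : R[i]) : cIm (x + y) = cIm x + cIm y.
Proof. by case: x y => [a b] [c d]. Qed.

Lemma cfunD u v t : cfun (u + v) t = cfun u t + cfun v t.
Proof.
apply: complex_ext; first by rewrite [LHS]cRe_cfun [RHS]cReD L2V1D.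
by rewrite [LHS]cIm_cfun [RHS]cImD L2V2D.
Qed.

Lemma cfunZ c u t : cfun (c *: u) t = (c%:C)%C * cfun u t.
Proof.
apply: complex_ext.
  by rewrite [LHS]cRe_cfun L2V1Z [RHS]cReM mul0r subr0.
by rewrite [LHS]cIm_cfun L2V2Z [RHS]cImM mul0r addr0.
Qed.

Lemma cfunB u v t : cfun (u - v) t = cfun u t - cfun v t.
Proof.
rewrite -scaleN1r cfunD cfunZ; congr (_ + _); apply: complex_ext.
  by rewrite cReM /= mul0r subr0 mulN1r; case: (cfun v t).
by rewrite cImM /= mul0r addr0 mulN1r; case: (cfun v t).
Qed.

Lemma cfun_inj : injective cfun.
Proof.
move=> [u1 u2] [v1 v2] e; congr (_, _); apply/LfuneqP => t.
- by have := congr1 (@^~ t) e => -[].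
- by have := congr1 (@^~ t) e => -[].
Qed.

Lemma L2_cfun v : L2 (cfun v).
Proof. by apply/L2_Lfun; split; exact: LfunP. Qed.

Lemma L2_lift f : exists v, L2 f -> cfun v = f.
Proof.
have [/[dup] Lf /L2_Lfun[f1 f2]|nLf] := pselect (L2 f); last by exists 0.
exists (Lfun_Sub one_le2 f1, Lfun_Sub one_le2 f2) => _.
by apply/funext => t; apply: complex_ext.
Qed.

(** Total inverse of [cfun], with a junk value outside of [L2]. *)
Definition toL2 f : L2V := sval (cid (L2_lift f)).

Lemma toL2K f : L2 f -> cfun (toL2 f) = f.
Proof. exact: svalP (cid (L2_lift f)). Qed.

Definition ip (u v : L2V) : R := ipf (cfun u) (cfun v).

Let dens (u v : L2V) t : R := u.1 t * v.1 t + u.2 t * v.2 t.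

Let ip_dens u v : ip u v = Rintegral mu setT (dens u v).
Proof. by []. Qed.

Let dens_int u v : mu.-integrable setT (fun t => (dens u v t)%:E).
Proof. exact: ipf_integrable (L2_cfun u) (L2_cfun v). Qed.

Lemma psd_ip : psd_form ip.
Proof.
split=> [x y|x y z|c x y|x]; last exact: ipf_ge0; rewrite !ip_dens.
- by apply: eq_Rintegral => t _; rewrite /dens; ring.
- rewrite -(RintegralD measurableT (dens_int x z) (dens_int y z)).
  by apply: eq_Rintegral => t _; rewrite /dens !L2VE; ring.
- rewrite -(RintegralZl c measurableT (dens_int x y)).
  by apply: eq_Rintegral => t _; rewrite /dens !L2VE; ring.
Qed.

(** Multiplication by the imaginary unit. *)
Definition mulJ (v : L2V) : L2V := (- v.2, v.1).

Lemma mulJ1 v t : (mulJ v).1 t = - v.2 t. Proof. by []. Qed.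
Lemma mulJ2 v t : (mulJ v).2 t = v.1 t. Proof. by []. Qed.

Lemma cfunJ v t : cfun (mulJ v) t = ('i * cfun v t)%C.
Proof.
apply: complex_ext.
  by rewrite [LHS]cRe_cfun mulJ1 [RHS]cReM mul0r mul1r sub0r.
by rewrite [LHS]cIm_cfun mulJ2 [RHS]cImM mul0r mul1r add0r.
Qed.

Lemma ip_mulJ u v : ip (mulJ u) (mulJ v) = ip u v.
Proof.
rewrite !ip_dens; apply: eq_Rintegral => t _.
by rewrite /dens !mulJ1 !mulJ2; ring.
Qed.

Lemma ip_mulJl u v : ip (mulJ u) v = - ip u (mulJ v).
Proof.
rewrite -mulN1r !ip_dens -(RintegralZl _ measurableT (dens_int _ _)).
by apply: eq_Rintegral => t _; rewrite /dens !mulJ1 !mulJ2; ring.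
Qed.

Definition cscal (c : R[i]) (v : L2V) : L2V := cRe c *: v + cIm c *: mulJ v.

Lemma cfun_cscal c v t : cfun (cscal c v) t = c * cfun v t.
Proof.
apply: complex_ext.
  by rewrite [LHS]cRe_cfun L2V1D !L2V1Z mulJ1 mulrN [RHS]cReM.
by rewrite [LHS]cIm_cfun L2V2D !L2V2Z mulJ2 [RHS]cImM.
Qed.

Lemma ip_cscalr u c v :
  ip u (cscal c v) = cRe c * ip u v + cIm c * ip u (mulJ v).
Proof. by rewrite (psdDr psd_ip) !(psdZr psd_ip). Qed.

(** [|<u, e>|^2], as a function of real inner products. *)
Definition absip2 u e : R := ip u e ^+ 2 + ip u (mulJ e) ^+ 2.

Lemma absip2_ge0 u e : 0 <= absip2 u e.
Proof. by rewrite addr_ge0// sqr_ge0. Qed.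

Lemma cRe_inner u e : cRe (inner (cfun u) (cfun e)) = ip u e.
Proof. exact: ipfE. Qed.

Lemma cIm_inner u e : cIm (inner (cfun u) (cfun e)) = ip u (mulJ e).
Proof. by rewrite Im_innerE; congr ipf; apply/funext => t; rewrite cfunJ. Qed.

Lemma normc_inner u e :
  Normc.normc (inner (cfun u) (cfun e)) ^+ 2 = absip2 u e.
Proof. by rewrite normc_sq cRe_inner cIm_inner. Qed.

Lemma psd_absip2 e : psd_form (fun u v =>
  ip u e * ip v e + ip u (mulJ e) * ip v (mulJ e)).
Proof.
split=> [x y|x y z|c x y|x]; first by ring.
- by rewrite !(psdDl psd_ip); ring.
- by rewrite !(psdZl psd_ip); ring.
- by rewrite -!expr2 absip2_ge0.
Qed.

Lemma absip2E u e :
  ip u e * ip u e + ip u (mulJ e) * ip u (mulJ e) = absip2 u e.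
Proof. by rewrite /absip2 !expr2. Qed.

Lemma cLnorm2_cfun v : cLnorm 2%:E (cfun v) = (Num.sqrt (ip v v))%:E.
Proof. by rewrite cLnorm2E//; exact: L2_cfun. Qed.

End L2Space.

(** * Completeness *)

Section L2Complete.
Context {R : realType}.
Local Notation mu := (@lebesgue_measure R).

Lemma sum_halfX_le2 N : \sum_(n < N) (2^-1 : R) ^+ n <= 2.
Proof.
have -> : \sum_(n < N) (2^-1 : R) ^+ n = 2 - 2 * 2^-1 ^+ N.
  elim: N => [|N ih]; first by rewrite big_ord0 expr0 mulr1 subrr.
  by rewrite big_ord_recr/= ih exprS; field.
by rewrite gerBl mulr_ge0// exprn_ge0// invr_ge0.
Qed.

(** Cauchy-Schwarz for the telescoping sum, the increment of index [j] having
    weight [2 ^ j]: the dual weights sum to [2 * 2^-1 ^+ n]. *)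
Lemma sqr_telescope_le (x : nat -> R) n k :
  (x (n + k)%N - x n) ^+ 2 <=
  2 * 2^-1 ^+ n * \sum_(n <= j < n + k) 2 ^+ j * (x j.+1 - x j) ^+ 2.
Proof.
elim: k n => [|k ih] n.
  by rewrite addn0 subrr expr0n/= big_geq// mulr0.
rewrite big_ltn ?addnS ?ltnS ?leq_addr//.
have := ih n.+1; rewrite addSn => {}ih.
set d := x n.+1 - x n; set S := \sum_(_ <= _ < _) _ in ih *.
have -> : x (n + k).+1 - x n = d + (x (n + k).+1 - x n.+1) by rewrite /d; ring.
set y := _ - x n.+1 in ih *.
have y0 : 0 <= (d - y) ^+ 2 by exact: sqr_ge0.
have -> : 2 * 2^-1 ^+ n * (2 ^+ n * d ^+ 2 + S) =
    2 * d ^+ 2 + 2 * (2 * 2^-1 ^+ n.+1 * S).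
  have e : 2^-1 ^+ n * 2 ^+ n = 1 :> R by rewrite -exprMn mulVf// expr1n.
  rewrite (exprS _ n) (_ : 2 * _ * _ = 2 * (2^-1 ^+ n * 2 ^+ n) * d ^+ 2 +
    2 * 2^-1 ^+ n * S); last by ring.
  by rewrite e; field.
rewrite (le_trans (_ : _ <= 2 * d ^+ 2 + 2 * y ^+ 2))//.
  by rewrite -subr_ge0 (_ : _ - _ = (d - y) ^+ 2)//; ring.
by rewrite lerD2l ler_pM2l.
Qed.

(** The function [G], the sum of the [2 ^ n * (u n.+1 - u n) ^ 2], has a finite
    integral, hence is finite almost everywhere. Where it is finite it makes
    [u n t] converge, and [(u n - l) ^ 2 <= 2 * 2^-1 ^+ n * G] everywhere, since
    the bound is infinite elsewhere. *)
Lemma Lfun2_complete (u : nat -> R -> R) :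
  (forall n, u n \in Lfun mu 2%:E) ->
  (forall n, (\int[mu]_t ((u n.+1 t - u n t) ^+ 2)%:E <= (4^-1 ^+ n)%:E)%E) ->
  exists2 l : R -> R, l \in Lfun mu 2%:E &
    forall n, (\int[mu]_t ((u n t - l t) ^+ 2)%:E <= (4 * 2^-1 ^+ n)%:E)%E.
Proof.
move=> uL ud.
have mu_ n : measurable_fun setT (u n) by have /Lfun2P[] := uL n.
pose w n t := (2 ^+ n * (u n.+1 t - u n t) ^+ 2)%:E : \bar R.
have w0 n t : (0 <= w n t)%E by rewrite lee_fin mulr_ge0 ?sqr_ge0 ?exprn_ge0.
have md n : measurable_fun setT (fun t => (u n.+1 t - u n t) ^+ 2).
  by apply: measurable_funX; exact: measurable_funB.
have mw n : measurable_fun setT (w n).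
  by apply/measurable_EFinP; apply: measurable_funM.
pose G t := (\sum_(0 <= n <oo) w n t)%E.
have G0 t : (0 <= G t)%E by exact: nneseries_ge0.
have mG : measurable_fun setT G.
  by apply: ge0_emeasurable_sum => // k t _ _; exact: w0.
have iG : (\int[mu]_t G t <= 2%:E)%E.
  rewrite integral_nneseries//.
  apply: lime_le; first by apply: is_cvg_nneseries => n _ _; exact: integral_ge0.
  apply: nearW => N; rewrite big_mkord.
  apply: (@le_trans _ _ (\sum_(n < N) (2^-1 ^+ n)%:E)%E); last first.
    by rewrite sumEFin lee_fin sum_halfX_le2.
  apply: lee_sum => n _; rewrite /w; under eq_integral do rewrite EFinM.
  rewrite ge0_integralZl_EFin ?exprn_ge0//; last 2 first.
  - by move=> t _; rewrite lee_fin sqr_ge0.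
  - by apply/measurable_EFinP; exact: md.
  apply: (@le_trans _ _ ((2 ^+ n)%:E * (4^-1 ^+ n)%:E)%E).
    by rewrite lee_pmul2l// ?lte_fin ?exprn_gt0//; exact: ud.
  rewrite -EFinM lee_fin -exprMn (_ : 2 * 4^-1 = 2^-1 :> R)//.
  by field.
have partial n k t : (\sum_(n <= j < n + k) w j t <= G t)%E.
  apply: (@le_trans _ _ (\sum_(0 <= j < n + k) w j t)%E).
    rewrite [leRHS](big_cat_nat (leq0n n) (leq_addr k n))/=.
    by rewrite leeDr// sume_ge0.
  exact: nneseries_lim_ge.
pose D := [set t | (G t < +oo)%E].
have mD : measurable D.
  by rewrite -[D]setTI; exact: emeasurable_fun_infty_o.
pose h n t := u n t * \1_D t.
have tel n k t : (((u (n + k)%N t - u n t) ^+ 2)%:E <=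
    (2 * 2^-1 ^+ n)%:E * G t)%E.
  apply: (@le_trans _ _ ((2 * 2^-1 ^+ n)%:E *
      \sum_(n <= j < n + k) w j t)%E); last first.
    by rewrite lee_pmul2l// lte_fin mulr_gt0 ?exprn_gt0 ?invr_gt0.
  by rewrite sumEFin -EFinM lee_fin; exact: (sqr_telescope_le (u ^~ t)).
have hcvg t : cvg (h n t @[n --> \oo]).
  have [tD|tD] := boolP (t \in D); last first.
    rewrite /h (_ : (fun n => _) = fun=> 0); first exact: is_cvg_cst.
    by apply/funext => n; rewrite indicE (negbTE tD) mulr0.
  rewrite /h (_ : (fun n => _) = u ^~ t); last first.
    by apply/funext => n; rewrite indicE tD mulr1.
  have Gfin : G t \is a fin_num by rewrite ge0_fin_numE//; move: tD; rewrite inE.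
  have cs : cvgn [normed series (fun n => u n.+1 t - u n t)].
    apply: nondecreasing_is_cvgn.
      by apply/nondecreasing_seqP => n; rewrite [leRHS]seriesSr; exact: ler_wpDr (normr_ge0 _) (lexx _).
    exists (fine (G t) + 2) => _ [N _ <-].
    change (\sum_(0 <= j < N) `|u j.+1 t - u j t| <= fine (G t) + 2).
    rewrite big_mkord.
    rewrite (le_trans (_ : _ <= \sum_(j < N)
      (2 ^+ j * (u j.+1 t - u j t) ^+ 2 + 2^-1 ^+ j)))//.
      apply: ler_sum => j _; set d := _ - _.
      have p0 : 0 < (2 : R) ^+ j by rewrite exprn_gt0.
      rewrite -[d ^+ 2]real_normK ?num_real//; move: `|d| (normr_ge0 d) => {}d d0.
      rewrite exprVn; move: (2 ^+ j) p0 => p p0.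
      have : 0 <= p^-1 * (p * d - 1) ^+ 2 by rewrite mulr_ge0 ?sqr_ge0 ?invr_ge0 ?ltW.
      rewrite (_ : p^-1 * _ = p * d ^+ 2 + p^-1 - 2 * d); last first.
        by field; rewrite gt_eqF.
      by move=> ?; lra.
    rewrite big_split/= lerD ?sum_halfX_le2//.
    by rewrite -lee_fin fineK// -sumEFin; have := partial 0 N t; rewrite big_mkord.
  have /normed_cvg cd := cs.
  rewrite (_ : u ^~ t = fun n => u 0 t + series (fun n => u n.+1 t - u n t) n).
    by apply: is_cvgD => //; exact: is_cvg_cst.
  apply/funext => n.
  change (u n t = u 0%N t + \sum_(0 <= j < n) (u j.+1 t - u j t)).
  rewrite telescope_sumr//.
  by rewrite addrC subrK.
pose l t := limn (h ^~ t).
have ml : measurable_fun setT l.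
  apply: (@measurable_fun_cvg _ _ _ setT h) => //.
  by move=> n; apply: measurable_funM => //; exact: measurable_indic.
have lt_le n t : (((u n t - l t) ^+ 2)%:E <= (2 * 2^-1 ^+ n)%:E * G t)%E.
  have [tD|] := boolP (t \in D); last first.
    rewrite notin_setE /D/= => /negP; rewrite -leNgt leye_eq => /eqP ->.
    by rewrite mulry gtr0_sg ?mul1e ?leey// mulr_gt0 ?exprn_gt0 ?invr_gt0.
  have Gfin : G t \is a fin_num by rewrite ge0_fin_numE//; move: tD; rewrite inE.
  rewrite -(fineK Gfin) -EFinM lee_fin.
  have ul : (u n t - u (n + k)%N t) ^+ 2 @[k --> \oo] --> (u n t - l t) ^+ 2.
    rewrite expr2; under eq_fun do rewrite expr2.
    have hl : u (n + k)%N t @[k --> \oo] --> l t.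
      have := hcvg t; rewrite (_ : h ^~ t = u ^~ t); last first.
        by apply/funext => m; rewrite /h indicE tD mulr1.
      move=> hc; have -> : l t = limn (u ^~ t).
        by congr (limn _); apply/funext => m; rewrite /h indicE tD mulr1.
      exact: (cvg_comp _ _ (cvg_addnl n) hc).
    by apply: cvgM; apply: cvgB => //; exact: cvg_cst.
  apply: cvgr_to_le ul _; apply: nearW => k.
  by rewrite -lee_fin [leRHS]EFinM fineK// -sqrrN opprB; exact: tel.
have il n : (\int[mu]_t ((u n t - l t) ^+ 2)%:E <= (4 * 2^-1 ^+ n)%:E)%E.
  apply: (@le_trans _ _ (\int[mu]_t ((2 * 2^-1 ^+ n)%:E * G t))%E).
    apply: ge0_le_integral => //.
    - by move=> t _; rewrite lee_fin sqr_ge0.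
    - apply/measurable_EFinP; apply: measurable_funX.
      exact: measurable_funB (mu_ n) ml.
    - exact: measurable_funeM.
  have p0 : 0 < 2 * 2^-1 ^+ n :> R by rewrite mulr_gt0 ?exprn_gt0 ?invr_gt0.
  rewrite ge0_integralZl_EFin ?(ltW p0)//.
  have -> : (4 * 2^-1 ^+ n)%:E = ((2 * 2^-1 ^+ n)%:E * 2%:E)%E :> \bar R.
    by rewrite -EFinM; congr EFin; ring.
  by rewrite lee_pmul2l.
exists l => //.
have hl : u 0%N - l \in Lfun mu 2%:E.
  apply/Lfun2P; split; first exact: measurable_funB (mu_ 0%N) ml.
  by apply: le_lt_trans (il 0%N) _; rewrite ltry.
have := rpredB (uL 0%N) hl; rewrite opprB addrC subrK.
by move=> /(_ (@one_le2 R)).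
Qed.

Lemma complete_ip : complete_form (@ip R).
Proof.
have ipE (v : @L2V R) : (ip v v)%:E =
    (\int[mu]_t (v.1 t ^+ 2)%:E + \int[mu]_t (v.2 t ^+ 2)%:E)%E.
  have m1 : measurable_fun setT (v.1 : R -> R) by have /Lfun2P[] := LfunP v.1.
  have m2 : measurable_fun setT (v.2 : R -> R) by have /Lfun2P[] := LfunP v.2.
  rewrite -int_sqmod; last exact: L2_cfun.
  rewrite -ge0_integralD//.
  - by move=> t _; rewrite lee_fin sqr_ge0.
  - by apply/measurable_EFinP; exact: (measurable_funX 2 m1).
  - by move=> t _; rewrite lee_fin sqr_ge0.
  - by apply/measurable_EFinP; exact: (measurable_funX 2 m2).
have sub1 (u v : @L2V R) t : (u - v).1 t = u.1 t - v.1 t.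
  by rewrite -scaleN1r L2V1D L2V1Z mulN1r.
have sub2 (u v : @L2V R) t : (u - v).2 t = u.2 t - v.2 t.
  by rewrite -scaleN1r L2V2D L2V2Z mulN1r.
have int0 (f : R -> R) : (0 <= \int[mu]_t (f t ^+ 2)%:E)%E.
  by apply: integral_ge0 => t _; rewrite lee_fin sqr_ge0.
move=> u ud.
have [|n|l1 L1 h1] := @Lfun2_complete (fun n => (u n).1 : R -> R).
- by move=> n; exact: LfunP.
- have := ud n; rewrite -lee_fin ipE; apply: le_trans.
  by under [in leRHS]eq_integral do rewrite sub1; rewrite leeDl.
have [|n|l2 L2 h2] := @Lfun2_complete (fun n => (u n).2 : R -> R).
- by move=> n; exact: LfunP.
- have := ud n; rewrite -lee_fin ipE; apply: le_trans.
  by under [X in (_ + X)%E]eq_integral do rewrite sub2; rewrite leeDr.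
pose l : @L2V R := (Lfun_Sub one_le2 L1, Lfun_Sub one_le2 L2).
exists l.
apply: (@squeeze_cvgr _ _ _ _ (fun=> 0) (fun n => 8 * 2^-1 ^+ n)).
- apply: nearW => n; rewrite psd_ge0//=; last exact: psd_ip.
  rewrite -lee_fin ipE (_ : 8 * _ = 4 * 2^-1 ^+ n + 4 * 2^-1 ^+ n); last by ring.
  rewrite [leRHS]EFinD; apply: leeD.
  + by under eq_integral do rewrite sub1; exact: h1.
  + by under eq_integral do rewrite sub2; exact: h2.
- exact: cvg_cst.
- rewrite (_ : 0 = 8 * 0); last by rewrite mulr0.
  apply: cvgMl_tmp; apply: cvg_expr.
  by rewrite ger0_norm ?invr_ge0// invf_lt1// ltr1n.
Qed.

End L2Complete.

(** * Translations and modulations *)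

Section Translation.
Context {R : realType}.
Local Notation mu := (@lebesgue_measure R).

Let shift (c : R) (t : measurableTypeR R) : measurableTypeR R := (t : R) - c.

Let measurable_shift c : measurable_fun setT (shift c).
Proof. exact: measurable_funB. Qed.

Lemma lebesgue_measure_shift c (A : set R) : measurable A ->
  pushforward mu (shift c) A = mu A.
Proof.
have ms := measurable_shift c.
move=> mA; apply/esym/lebesgue_measure_unique => //= _ [[x y]] _ <-.
rewrite /pushforward.
have -> : shift c @^-1` [set` `]x, y]] = [set` `]x + c, y + c]].
  apply/seteqP; split => t /=; rewrite !in_itv/= /shift.
    by rewrite ltrBrDr lerBlDr.
  by rewrite ltrBrDr lerBlDr.
rewrite !lebesgue_measure_itv/= !lte_fin ltrD2r; case: ifPn => // _.
by congr (_%:E); ring.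
Qed.

Lemma ge0_integral_shift (c : R) (D : set R) (f : R -> \bar R) :
  measurable D -> measurable_fun D f -> (forall t, 0 <= f t)%E ->
  (\int[mu]_(t in [set t | D (t - c)%R]) f (t - c)%R = \int[mu]_(t in D) f t)%E.
Proof.
move=> mD mf f0.
rewrite -[LHS](@ge0_integral_pushforward _ _ _ _ _ _ (measurable_shift c) mu D)//.
by apply: eq_measure_integral => A mA _; exact: lebesgue_measure_shift.
Qed.

Lemma ge0_integralT_shift (c : R) (f : R -> \bar R) :
  measurable_fun setT f -> (forall t, 0 <= f t)%E ->
  (\int[mu]_t f (t - c)%R = \int[mu]_t f t)%E.
Proof.
move=> mf f0; rewrite -(ge0_integral_shift c measurableT mf f0).
by congr (integral _ _ _); apply/seteqP.
Qed.

Lemma integral_shift (c : R) (f : R -> \bar R) : measurable_fun setT f ->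
  mu.-integrable setT (fun t => f (t - c)%R) ->
  (\int[mu]_t f (t - c)%R = \int[mu]_t f t)%E.
Proof.
move=> mf fi.
have := @integral_pushforward _ _ _ _ _ _ (measurable_shift c) mu setT f mf.
rewrite preimage_setT => /(_ fi measurableT) <-.
by apply: eq_measure_integral => A mA _; exact: lebesgue_measure_shift.
Qed.

End Translation.

Section ModulateTranslate.
Context {R : realType}.
Local Notation mu := (@lebesgue_measure R).
Implicit Types f g : R -> R[i].

Definition cis (x : R) : R[i] := Complex (cos x) (sin x).

Lemma cisD x y : cis (x + y) = cis x * cis y.
Proof.
apply: complex_ext; rewrite ?cReM ?cImM /= ?cosD ?sinD //; ring.
Qed.

Lemma cis0 : cis 0 = 1.
Proof. by rewrite /cis cos0 sin0. Qed.

Lemma modulateE c f t : modulate c f t = cis (2 * pi * c * t) * f t.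
Proof. by []. Qed.

Lemma cis_mul_ip (z x y : R[i]) : cRe z ^+ 2 + cIm z ^+ 2 = 1 ->
  cRe (z * x) * cRe (z * y) + cIm (z * x) * cIm (z * y) =
  cRe x * cRe y + cIm x * cIm y.
Proof.
move=> z1; rewrite !cReM !cImM.
transitivity ((cRe z ^+ 2 + cIm z ^+ 2) * (cRe x * cRe y + cIm x * cIm y)).
  by ring.
by rewrite z1 mul1r.
Qed.

Lemma cis_unit x : cRe (cis x) ^+ 2 + cIm (cis x) ^+ 2 = 1.
Proof. exact: cos2Dsin2. Qed.

Lemma sqmod_modulate c f t : sqmod (modulate c f) t = sqmod f t.
Proof.
have := cis_mul_ip (f t) (f t) (cis_unit (2 * pi * c * t)).
by rewrite -!expr2 -modulateE.
Qed.

Lemma ipf_modulate c f g : ipf (modulate c f) (modulate c g) = ipf f g.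
Proof.
by apply: eq_Rintegral => t _; rewrite !modulateE cis_mul_ip// cis_unit.
Qed.

Lemma measurable_cis c : measurable_fun setT (fun t : R => cRe (cis (c * t))) /\
  measurable_fun setT (fun t : R => cIm (cis (c * t))).
Proof.
split; apply: measurableT_comp => //; apply: continuous_measurable_fun => /=.
  exact: continuous_cos.
exact: continuous_sin.
Qed.

Lemma L2_modulate c f : L2 f -> L2 (modulate c f).
Proof.
rewrite !L2E => -[mr mi h]; have [mc ms] := measurable_cis (2 * pi * c).
split.
- have -> : cRe \o modulate c f = (fun t =>
      cRe (cis (2 * pi * c * t)) * cRe (f t) -
      cIm (cis (2 * pi * c * t)) * cIm (f t)).
    by apply/funext => t; rewrite /= modulateE cReM.
  by apply: measurable_funB; apply: measurable_funM.
- have -> : cIm \o modulate c f = (fun t =>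
      cRe (cis (2 * pi * c * t)) * cIm (f t) +
      cIm (cis (2 * pi * c * t)) * cRe (f t)).
    by apply/funext => t; rewrite /= modulateE cImM.
  by apply: measurable_funD; apply: measurable_funM.
- by under eq_integral do rewrite sqmod_modulate.
Qed.

Lemma measurable_translate (d : R) (h : R -> R) : measurable_fun setT h ->
  measurable_fun setT (fun t : R => h (t - d)).
Proof. by move=> mh; apply: measurableT_comp => //; exact: measurable_funB. Qed.

Lemma L2_translate d f : L2 f -> L2 (translate d f).
Proof.
rewrite !L2E => -[mr mi h]; split.
- exact: measurable_translate mr.
- exact: measurable_translate mi.
- rewrite (@ge0_integralT_shift _ d (fun t => (sqmod f t)%:E))//.
  + by apply/measurable_EFinP; exact: measurable_sqmod.
  + by move=> t; rewrite lee_fin sqmod_ge0.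
Qed.

Lemma ipf_translate d f g : L2 f -> L2 g ->
  ipf (translate d f) (translate d g) = ipf f g.
Proof.
move=> Lf Lg; congr fine.
pose F t := (cRe (f t) * cRe (g t) + cIm (f t) * cIm (g t))%:E.
apply: (@integral_shift _ d F).
  exact: measurable_int (ipf_integrable Lf Lg).
exact: ipf_integrable (L2_translate d Lf) (L2_translate d Lg).
Qed.

Lemma modulateK c f : modulate c (modulate (- c) f) = f.
Proof.
by apply/funext => t; rewrite !modulateE mulrA -cisD mulrN mulNr subrr cis0 mul1r.
Qed.

Lemma translateK d f : translate d (translate (- d) f) = f.
Proof. by apply/funext => t; rewrite /translate opprK subrK. Qed.

(** The time-frequency shift [E_c T_d]. *)
Definition shiftop (c d : R) (v : L2V) : L2V :=
  toL2 (modulate c (translate d (cfun v))).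

Lemma cfun_shiftop c d v :
  cfun (shiftop c d v) = modulate c (translate d (cfun v)).
Proof. by rewrite toL2K//; apply/L2_modulate/L2_translate/L2_cfun. Qed.

Lemma ip_shiftop c d u v : ip (shiftop c d u) (shiftop c d v) = ip u v.
Proof.
by rewrite /ip !cfun_shiftop ipf_modulate ipf_translate//; exact: L2_cfun.
Qed.

Lemma shiftop_surj c d v : exists u, shiftop c d u = v.
Proof.
exists (toL2 (translate (- d) (modulate (- c) (cfun v)))).
apply: cfun_inj; rewrite cfun_shiftop toL2K; first by rewrite translateK modulateK.
by apply/L2_translate/L2_modulate/L2_cfun.
Qed.

Lemma shiftopD c d u v : shiftop c d (u + v) = shiftop c d u + shiftop c d v.
Proof.
apply: cfun_inj; apply/funext => t.
by rewrite cfunD !cfun_shiftop !modulateE /translate cfunD mulrDr.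
Qed.

Lemma shiftopZ c d k u : shiftop c d (k *: u) = k *: shiftop c d u.
Proof.
apply: cfun_inj; apply/funext => t.
by rewrite cfunZ !cfun_shiftop !modulateE /translate cfunZ mulrCA.
Qed.

Lemma shiftopJ c d u : shiftop c d (mulJ u) = mulJ (shiftop c d u).
Proof.
apply: cfun_inj; apply/funext => t.
by rewrite cfunJ !cfun_shiftop !modulateE /translate cfunJ mulrCA.
Qed.

Lemma absip2_shiftop c d u v : absip2 (shiftop c d u) (shiftop c d v) = absip2 u v.
Proof. by rewrite /absip2 -shiftopJ !ip_shiftop. Qed.

Lemma absip2_cscal (z : R[i]) (u e : @L2V R) : absip2 u (cscal z e) =
  (cRe z ^+ 2 + cIm z ^+ 2) * absip2 u e.
Proof.
have JJ (v : @L2V R) : mulJ (mulJ v) = - v by case: v => ? ?; congr (_, _).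
rewrite /absip2 ip_cscalr.
have -> : mulJ (cscal z e) = cscal z (mulJ e).
  apply: cfun_inj; apply/funext => t.
  by rewrite cfunJ !cfun_cscal cfunJ mulrCA.
by rewrite ip_cscalr JJ (psdNr psd_ip); ring.
Qed.

(** Up to a unimodular factor, time-frequency shifts form a group. *)
Lemma absip2_shiftop_shift (c d c' d' : R) (u v : @L2V R) :
  absip2 (shiftop c d u) (shiftop c' d' v) =
  absip2 u (shiftop (c' - c) (d' - d) v).
Proof.
pose z := cis (2 * pi * ((c' - c) * d)).
have -> : shiftop c' d' v =
    shiftop c d (cscal z (shiftop (c' - c) (d' - d) v)).
  apply: cfun_inj; apply/funext => t.
  rewrite !cfun_shiftop !modulateE /translate cfun_cscal cfun_shiftop modulateE.
  rewrite /translate !mulrA -!cisD.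
  by congr (_ * _); [congr cis; ring|congr (cfun v _); ring].
by rewrite absip2_shiftop absip2_cscal cis_unit mul1r.
Qed.

Lemma WH_systemE (v : L2V) a b mn : WH_system (cfun v) a b mn =
  cfun (shiftop (mn.1%:~R * b) (mn.2%:~R * a) v).
Proof. by rewrite cfun_shiftop. Qed.

End ModulateTranslate.

(** * Unordered sums *)

Section Esum.
Context {R : realType}.

Lemma esum_le_seq {I : choiceType} (a : I -> \bar R) (M : \bar R) :
  (forall i, 0 <= a i)%E ->
  (forall l : seq I, uniq l -> \sum_(i <- l) a i <= M)%E ->
  (\esum_(i in [set: I]) a i <= M)%E.
Proof.
move=> a0 h; apply: ge_ereal_sup => _ [X [fX _] <-].
by rewrite fsbig_finite//=; exact: h.
Qed.

Lemma esum_ge_seq {I : choiceType} (a : I -> \bar R) (l : seq I) :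
  (forall i, 0 <= a i)%E -> uniq l ->
  (\sum_(i <- l) a i <= \esum_(i in [set: I]) a i)%E.
Proof.
move=> a0 ul; apply: esum_ge; exists [set` l] => //.
by rewrite fsbig_seq.
Qed.

Lemma esum_nneseries {I : choiceType} (a : I -> \bar R) (s : nat -> I) :
  (forall i, 0 <= a i)%E -> bijective s ->
  (\esum_(i in [set: I]) a i = \sum_(0 <= k <oo) a (s k))%E.
Proof.
move=> a0 bs; rewrite nneseries_esumT//.
by apply: reindex_esum; rewrite setTT_bijective.
Qed.

Lemma enum_of_surj (I : countType) (f : I -> nat) :
  (forall n, exists i, f i = n) -> exists s : nat -> I, bijective s.
Proof.
move=> fs.
have : ([set: I] #= [set: nat])%card.
  apply: eq_card_nat; first exact: countableP.
  move=> fin; apply: infinite_nat.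
  rewrite (_ : [set: nat] = f @` setT); first exact: finite_image.
  by apply/seteqP; split => // n _; have [i <-] := fs n; exists i.
move=> /card_set_bijP[g]; rewrite setTT_bijective => -[h gK hK].
by exists h; exists g.
Qed.

Lemma enum_int : exists s : nat -> int, bijective s.
Proof. by apply: (enum_of_surj (f := absz)) => n; exists n%:Z. Qed.

Lemma enum_int2 : exists s : nat -> int * int, bijective s.
Proof.
by apply: (enum_of_surj (f := fun i : int * int => `|i.1|%N)) => n; exists (n%:Z, 0).
Qed.

Lemma esumZl {I : choiceType} (s : nat -> I) (a : I -> \bar R) (k : R) :
  bijective s -> (forall i, 0 <= a i)%E -> 0 <= k ->
  (\esum_(i in [set: I]) (k%:E * a i) = k%:E * \esum_(i in [set: I]) a i)%E.
Proof.
move=> bs a0 k0.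
rewrite !(esum_nneseries _ bs)//; last by move=> i; rewrite mule_ge0.
by rewrite nneseriesZl.
Qed.

Lemma esum_swap (a : int -> int -> \bar R) : (forall i j, 0 <= a i j)%E ->
  (\esum_(i in [set: int]) \esum_(j in [set: int]) a i j =
   \esum_(j in [set: int]) \esum_(i in [set: int]) a i j)%E.
Proof.
move=> a0; rewrite !esum_esum//.
rewrite (@reindex_esum _ _ _ (setT `*`` fun=> setT) _ (fun k => (k.2, k.1)))//.
split=> //; first by move=> [m n] [m' n'] _ _ [-> ->].
by move=> [m n] _; exists (n, m).
Qed.

Lemma esum_shift (a : int -> \bar R) (n : int) :
  (\esum_(i in [set: int]) a (i + n)%R = \esum_(i in [set: int]) a i)%E.
Proof.
rewrite [RHS](@reindex_esum _ _ _ setT _ (fun i => i + n))//.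
rewrite setTT_bijective; exists (fun i => i - n); first exact: addrK.
exact: subrK.
Qed.

End Esum.

(** * Bessel families and frames *)

Section Frames.
Context {R : realType}.
Local Notation V := (@L2V R).
Implicit Types (e : int * int -> V) (s : nat -> int * int) (u v w x y f : V).

Definition frame_sum e (x : V) : \bar R :=
  (\esum_(i in [set: int * int]) (absip2 x (e i))%:E)%E.

Definition bessel e B := forall x, (frame_sum e x <= (B * ip x x)%:E)%E.

Definition frame_below e A := forall x, ((A * ip x x)%:E <= frame_sum e x)%E.

(** The form [Re <S x, y>] of the frame operator [S]. Defined through
    [frame_sum], it does not depend on an enumeration of the family. *)
Definition frame_form e : V -> V -> R := polar (fun x => fine (frame_sum e x)).

(** The Fourier coefficient [<u, v>] as a complex number. *)
Definition coef (u v : V) : R[i] := Complex (ip u v) (ip u (mulJ v)).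

Lemma frame_sum_ge0 e x : (0 <= frame_sum e x)%E.
Proof. by apply: esum_ge0 => i _; rewrite lee_fin absip2_ge0. Qed.

Definition partial_form e s N (x y : V) : R := \sum_(k < N)
  (ip x (e (s k)) * ip y (e (s k)) + ip x (mulJ (e (s k))) * ip y (mulJ (e (s k)))).

Lemma psd_partial_form e s N : psd_form (partial_form e s N).
Proof. by apply: psd_form_sum => k; exact: psd_absip2. Qed.

Lemma partial_formE e s N x :
  partial_form e s N x x = \sum_(k < N) absip2 x (e (s k)).
Proof. by apply: eq_bigr => k _; exact: absip2E. Qed.

Lemma ip_cscall c u v : ip (cscal c u) v = cRe c * ip u v + cIm c * ip (mulJ u) v.
Proof. by rewrite /cscal (psdDl psd_ip) !(psdZl psd_ip). Qed.

(** The partial sums of [frame_form] at [u] are products with the partial sums of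
    the expansion of [S u], for any enumeration. *)
Lemma partial_form_ip e s N u y : partial_form e s N u y =
  ip (\sum_(k < N) cscal (coef u (e (s k))) (e (s k))) y.
Proof.
rewrite (psd_suml psd_ip); apply: eq_bigr => k _.
by rewrite ip_cscall !(psdC psd_ip y).
Qed.

Section Bessel.
Context {e : int * int -> V} {B : R} (hB : bessel e B).

Lemma frame_sum_fin x : frame_sum e x \is a fin_num.
Proof. by rewrite ge0_fin_numE ?frame_sum_ge0// (le_lt_trans (hB x))// ltry. Qed.

Lemma partial_form_le s N x : bijective s ->
  partial_form e s N x x <= fine (frame_sum e x).
Proof.
move=> bs; rewrite partial_formE -lee_fin fineK ?frame_sum_fin// -sumEFin.
rewrite /frame_sum (esum_nneseries _ bs); last first.
  by move=> i; rewrite lee_fin absip2_ge0.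
rewrite -(big_mkord xpredT (fun k => (absip2 x (e (s k)))%:E)).
by apply: nneseries_lim_ge => k _ _; rewrite lee_fin absip2_ge0.
Qed.

Lemma cvg_partial_form s x : bijective s ->
  partial_form e s N x x @[N --> \oo] --> fine (frame_sum e x).
Proof.
move=> bs; apply: (@fine_cvg _ _ _ _ (fun N => (partial_form e s N x x)%:E)).
rewrite fineK ?frame_sum_fin//.
rewrite /frame_sum (esum_nneseries _ bs); last first.
  by move=> i; rewrite lee_fin absip2_ge0.
have -> : (fun N => (partial_form e s N x x)%:E) =
    (fun N => \sum_(0 <= k < N) (absip2 x (e (s k)))%:E)%E.
  by apply/funext => N; rewrite partial_formE -sumEFin big_mkord.
by apply: is_cvg_nneseries => k _ _; rewrite lee_fin absip2_ge0.
Qed.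

Lemma psd_frame_form : psd_form (frame_form e).
Proof.
have [s bs] := enum_int2.
by have [] := polar_psd_form (psd_partial_form e s) (fun x => @cvg_partial_form s x bs).
Qed.

Lemma frame_formE x : (frame_form e x x)%:E = frame_sum e x.
Proof.
have [s bs] := enum_int2.
have [_ h] := polar_psd_form (psd_partial_form e s) (fun x => @cvg_partial_form s x bs).
by rewrite [frame_form e x x]h fineK ?frame_sum_fin.
Qed.

Lemma fine_frame_sum x : fine (frame_sum e x) = frame_form e x x.
Proof. by rewrite -frame_formE. Qed.

Lemma frame_form_le x : frame_form e x x <= B * ip x x.
Proof. by rewrite -lee_fin frame_formE. Qed.

Lemma frame_form_ge A x : frame_below e A -> A * ip x x <= frame_form e x x.
Proof. by move=> hA; rewrite -lee_fin frame_formE. Qed.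

Lemma cvg_frame_expansion f u s : 0 < B -> bijective s ->
  (forall y, frame_form e u y = ip f y) ->
  let w N := f - \sum_(k < N) cscal (coef u (e (s k))) (e (s k)) in
  ip (w N) (w N) @[N --> \oo] --> 0.
Proof.
move=> B0 bs uf w.
apply: (cvg_reconstruction psd_ip psd_frame_form (psd_partial_form e s) B0 _
  frame_form_le _ uf (fun N y => partial_form_ip e s N u y)).
- by move=> N x; rewrite -fine_frame_sum partial_form_le.
- by rewrite -fine_frame_sum; exact: cvg_partial_form.
Qed.

(** The equation [S u = f], in weak form. *)
Lemma frame_solve A f : 0 < A -> frame_below e A ->
  exists u, forall y, frame_form e u y = ip f y.
Proof.
move=> A0 hA; apply: (lax_milgram complete_ip psd_frame_form psd_ip A0 ltr01
  (fun x => frame_form_ge x hA) frame_form_le) => x.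
by rewrite mul1r.
Qed.

(** Synthesis is adjoint to analysis, hence has the same bound. *)
Lemma bessel_synthesis s N (c : nat -> R[i]) v : 0 < B -> bijective s ->
  v = \sum_(k < N) cscal (c k) (e (s k)) ->
  ip v v <= B * \sum_(k < N) Normc.normc (c k) ^+ 2.
Proof.
move=> B0 bs vE.
have h k : 2 * ip (cscal (c k) (e (s k))) v <=
    B * Normc.normc (c k) ^+ 2 + B^-1 * absip2 v (e (s k)).
  rewrite ip_cscall normc_sq /absip2 !(psdC psd_ip _ v).
  move: (ip v _) (ip v _) (cRe _) (cIm _) => q p a d.
  have : 0 <= B^-1 * ((B * a - p) ^+ 2 + (B * d - q) ^+ 2).
    by rewrite mulr_ge0 ?invr_ge0 ?(ltW B0)// addr_ge0// sqr_ge0.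
  rewrite (_ : B^-1 * _ = (B * (a ^+ 2 + d ^+ 2) + B^-1 * (p ^+ 2 + q ^+ 2)) -
    2 * (a * p + d * q)) ?subr_ge0//.
  by field; rewrite gt_eqF.
have : 2 * ip v v <= B * \sum_(k < N) Normc.normc (c k) ^+ 2 + ip v v.
  rewrite {1}vE (psd_suml psd_ip) mulr_sumr.
  apply: (@le_trans _ _ (\sum_(k < N)
      (B * Normc.normc (c k) ^+ 2 + B^-1 * absip2 v (e (s k))))).
    by apply: ler_sum => k _; exact: h.
  rewrite big_split/= -!mulr_sumr lerD2l -(partial_formE e s N v) mulrC ler_pdivrMr//.
  rewrite mulrC (le_trans _ (frame_form_le v))// -fine_frame_sum.
  exact: partial_form_le.
by move=> ?; lra.
Qed.

End Bessel.

Lemma frame_sum_seq e x l : uniq l ->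
  ((\sum_(i <- l) absip2 x (e i))%:E <= frame_sum e x)%E.
Proof.
move=> ul; rewrite -sumEFin; apply: esum_ge_seq => // i.
by rewrite lee_fin absip2_ge0.
Qed.

End Frames.

(** * Frames which are bases, and perturbations *)

Section FramesAndBases.
Context {R : realType}.
Local Notation V := (@L2V R).
Implicit Types (e : int * int -> V) (s : nat -> int * int) (u v w x y f : V).

Lemma is_frameP e A B : is_frame (fun i => cfun (e i)) A B <->
  [/\ 0 < A, 0 < B, frame_below e A & bessel e B].
Proof.
have sumE x : (\esum_(i in [set: int * int])
    (Normc.normc (inner (cfun x) (cfun (e i))) ^+ 2)%:E)%E = frame_sum e x.
  by apply: eq_esum => i _; rewrite normc_inner.
have normE x (C : R) : (C%:E * cLnorm 2%:E (cfun x) ^+ 2 = (C * ip x x)%:E)%E.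
  by rewrite cLnorm2_sq ?EFinM//; exact: L2_cfun.
split=> [[_ A0 B0 h]|[A0 B0 hA hB]].
  by split => // x; have /andP[] := h _ (L2_cfun x); rewrite sumE !normE.
split => // [i|f Lf]; first exact: L2_cfun.
by rewrite -(toL2K Lf) sumE !normE hA hB.
Qed.

Lemma cfun_sum (N : nat) (c : nat -> R[i]) (E : nat -> V) t :
  cfun (\sum_(k < N) cscal (c k) (E k)) t = \sum_(k < N) c k * cfun (E k) t.
Proof.
elim: N => [|N ih]; last by rewrite !big_ord_recr/= cfunD ih cfun_cscal.
by rewrite !big_ord0 -(scale0r 0) cfunZ mul0r.
Qed.

Lemma expansionP (E : nat -> V) (c : nat -> R[i]) v :
  let w N := v - \sum_(k < N) cscal (c k) (E k) in
  expansion (fun k => cfun (E k)) c (cfun v) <->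
  (ip (w N) (w N) @[N --> \oo] --> 0).
Proof.
move=> w; rewrite /expansion.
have -> : (fun N => cLnorm 2%:E
    (fun t => cfun v t - \sum_(k < N) c k * cfun (E k) t)) =
    (fun N => (Num.sqrt (ip (w N) (w N)))%:E).
  apply/funext => N; rewrite -cLnorm2_cfun; congr (cLnorm _ _).
  by apply/funext => t; rewrite cfunB cfun_sum.
split=> h.
  have {}h : Num.sqrt (ip (w N) (w N)) @[N --> \oo] --> 0.
    exact: (@fine_cvg _ _ _ _ (fun N => (Num.sqrt (ip (w N) (w N)))%:E) 0 h).
  have -> : (fun N => ip (w N) (w N)) =
      (fun N => Num.sqrt (ip (w N) (w N)) * Num.sqrt (ip (w N) (w N))).
    by apply/funext => N; rewrite -expr2 sqr_sqrtr// psd_ge0//; exact: psd_ip.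
  by rewrite -[X in _ --> X](mulr0 0); exact: (cvgM h h).
apply: cvg_EFin; first exact: nearW.
rewrite -(@sqrtr0 R); apply: (@cvg_comp _ _ _ _ Num.sqrt _ _ _ h).
exact: sqrt_continuous.
Qed.

Lemma cscalBl (c d : R[i]) v : cscal (c - d) v = cscal c v - cscal d v.
Proof.
apply: cfun_inj; apply/funext => t.
by rewrite [RHS]cfunB !cfun_cscal mulrBl.
Qed.

Lemma cscalDr (c : R[i]) u v : cscal c (u + v) = cscal c u + cscal c v.
Proof.
apply: cfun_inj; apply/funext => t.
by rewrite [RHS]cfunD !cfun_cscal cfunD mulrDr.
Qed.

(** If [S u = v] then the frame expands [v] with the coefficients of [u]. In a
    basis expansions are unique, so these are the given [c k], and the sum of their
    squares is at most [frame_form e u u]. Finally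
    [A * frame_form e u u <= ip v v], by Young's inequality and [ip v u = frame_form e u u]. *)
Lemma riesz_lower_bound e A B : 0 < A -> 0 < B ->
  frame_below e A -> bessel e B -> unconditional_basis (fun i => cfun (e i)) ->
  forall s N (c : nat -> R[i]) v, bijective s ->
    v = \sum_(k < N) cscal (c k) (e (s k)) ->
    A * \sum_(k < N) Normc.normc (c k) ^+ 2 <= ip v v.
Proof.
move=> A0 B0 hA hB [_ basis] s N c v bs vE.
have [u uv] := frame_solve hB v A0 hA.
have [s' sK s'K] := bs.
(* the coefficients [c], moved to the index set and extended by [0] *)
pose c1 i : R[i] := if (s' i < N)%N then c (s' i) else 0.
have [c0 [_ uniq0]] := basis _ (L2_cfun v).
have e1 : c1 =1 c0.
  apply: (uniq0 s) => //; apply/expansionP => /=.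
  rewrite (_ : (fun M => _) = (fun M =>
    ip (v - \sum_(k < M) cscal (c1 (s k)) (e (s k)))
       (v - \sum_(k < M) cscal (c1 (s k)) (e (s k)))))//.
  apply: cvg_near_cst; exists N => // M /= NM.
  have -> : \sum_(k < M) cscal (c1 (s k)) (e (s k)) = v.
    rewrite vE (big_ord_widen M (fun k => cscal (c k) (e (s k))) NM).
    rewrite [RHS]big_mkcond/=; apply: eq_bigr => k _.
    rewrite /c1 sK; case: ifP => // _.
    by rewrite /cscal !scale0r addr0.
  by rewrite subrr (psd0l psd_ip).
have e2 : (fun i => coef u (e i)) =1 c0.
  apply: (uniq0 s) => //; apply/expansionP => /=.
  exact: (cvg_frame_expansion hB B0 bs uv).
have ck (k : 'I_N) : c k = coef u (e (s k)).
  by rewrite [RHS]e2 -e1 /c1 sK ltn_ord.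
have -> : \sum_(k < N) Normc.normc (c k) ^+ 2 = partial_form e s N u u.
  by rewrite partial_formE; apply: eq_bigr => k _; rewrite ck normc_sq.
have Ai : 0 < A^-1 by rewrite invr_gt0.
have h1 := psd_young psd_ip v u Ai; rewrite invrK -uv in h1.
have h2 := frame_form_ge hB u hA.
have h3 : partial_form e s N u u <= A^-1 * ip v v.
  have := partial_form_le hB N u bs; rewrite (fine_frame_sum hB); lra.
rewrite (le_trans (_ : _ <= A * (A^-1 * ip v v))) ?ler_pM2l//.
by rewrite mulrA mulfV ?mul1r ?gt_eqF.
Qed.

(** The expansion with the coefficients of [u], where [S u = f], converges along
    every enumeration. If other coefficients also give [f], the differences of the
    partial sums tend to [0], and the lower bound makes each difference of
    coefficients vanish. *)
Lemma basis_of_lower_bound e A B A' : 0 < A -> 0 < B -> 0 < A' ->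
  frame_below e A -> bessel e B ->
  (forall s N (c : nat -> R[i]) v, bijective s ->
    v = \sum_(k < N) cscal (c k) (e (s k)) ->
    A' * \sum_(k < N) Normc.normc (c k) ^+ 2 <= ip v v) ->
  unconditional_basis (fun i => cfun (e i)).
Proof.
move=> A0 B0 A'0 hA hB low; split=> [i|f' /toL2K <-]; first exact: L2_cfun.
move: (toL2 f') => {f'} f.
have [u uf] := frame_solve hB f A0 hA.
have exp s : bijective s ->
    (ip (f - \sum_(k < N) cscal (coef u (e (s k))) (e (s k)))
       (f - \sum_(k < N) cscal (coef u (e (s k))) (e (s k)))) @[N --> \oo] --> 0.
  by move=> bs; exact: (cvg_frame_expansion hB B0 bs uf).
exists (fun i => coef u (e i)); split => [s bs|s c' bs].
  by apply/expansionP; exact: exp.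
move=> /expansionP/= h i; have [s' sK s'K] := bs.
rewrite -(s'K i); move: (s' i) => k {i s' sK s'K}.
pose d k := c' (s k) - coef u (e (s k)).
pose x N := \sum_(k < N) cscal (d k) (e (s k)).
pose y1 N := f - \sum_(k < N) cscal (coef u (e (s k))) (e (s k)).
pose y2 N := f - \sum_(k < N) cscal (c' (s k)) (e (s k)).
have xE N : x N = y1 N - y2 N.
  rewrite /y1 /y2 opprB addrC addrA subrK -sumrB; apply: eq_bigr => j _.
  exact: cscalBl.
have x0 : ip (x N) (x N) @[N --> \oo] --> 0.
  apply: (@squeeze_cvgr _ _ _ _ (fun=> 0)
    (fun N => 2 * (ip (y1 N) (y1 N) + ip (y2 N) (y2 N)))).
  - apply: nearW => N; rewrite (psd_ge0 psd_ip)/= xE.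
    exact: (psd_sqB_le2 psd_ip).
  - exact: cvg_cst.
  - rewrite (_ : 0 = 2 * (0 + 0)); last by rewrite addr0 mulr0.
    by apply: cvgMl_tmp; apply: cvgD; [exact: exp|exact: h].
have : A' * Normc.normc (d k) ^+ 2 <= 0.
  apply: cvgr_to_ge x0 _; exists k.+1 => // N /= kN.
  rewrite (le_trans _ (low s N d _ bs erefl))// ler_pM2l//.
  rewrite (bigD1 (Ordinal kN))//= lerDl sumr_ge0// => j _.
  exact: sqr_ge0.
rewrite pmulr_rle0// => d0.
have /eqP : Normc.normc (d k) ^+ 2 == 0 by rewrite eq_le d0 sqr_ge0.
move=> /eqP; rewrite sqrf_eq0 => /eqP/Normc.eq0_normc/eqP.
by rewrite subr_eq0 => /eqP.
Qed.

Lemma mulJD u v : mulJ (u + v) = mulJ u + mulJ v.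
Proof.
apply: cfun_inj; apply/funext => z.
by rewrite [RHS]cfunD !cfunJ cfunD mulrDr.
Qed.

Lemma mulJN u : mulJ (- u) = - mulJ u.
Proof. by []. Qed.

Lemma absip2_young x u v t : 0 < t ->
  absip2 x (u + v) <= (1 + t) * absip2 x u + (1 + t^-1) * absip2 x v.
Proof.
move=> t0; rewrite /absip2 mulJD !(psdDr psd_ip).
move: (ip x u) (ip x v) (ip x (mulJ u)) (ip x (mulJ v)) => p q p' q'.
have : 0 <= t^-1 * ((t * p - q) ^+ 2 + (t * p' - q') ^+ 2).
  by rewrite mulr_ge0 ?invr_ge0 ?(ltW t0)// addr_ge0// sqr_ge0.
move=> h; rewrite -subr_ge0.
rewrite (_ : _ - _ = t^-1 * ((t * p - q) ^+ 2 + (t * p' - q') ^+ 2))//.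
by field; rewrite gt_eqF.
Qed.

Lemma absip2N x u : absip2 x (- u) = absip2 x u.
Proof.
by rewrite /absip2 mulJN !(psdNr psd_ip) !sqrrN.
Qed.

Lemma bessel_sum e1 e2 B1 B2 t : 0 < t -> bessel e1 B1 -> bessel e2 B2 ->
  bessel (fun i => e1 i + e2 i) ((1 + t) * B1 + (1 + t^-1) * B2).
Proof.
move=> t0 h1 h2 x; apply: esum_le_seq => [i|l ul].
  by rewrite lee_fin absip2_ge0.
rewrite sumEFin lee_fin.
have {}h1 := le_trans (frame_sum_seq e1 x ul) (h1 x).
have {}h2 := le_trans (frame_sum_seq e2 x ul) (h2 x).
rewrite !lee_fin in h1 h2.
apply: (@le_trans _ _ (\sum_(i <- l)
    ((1 + t) * absip2 x (e1 i) + (1 + t^-1) * absip2 x (e2 i)))).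
  by apply: ler_sum => i _; exact: absip2_young.
rewrite big_split/= -!mulr_sumr [leRHS]mulrDl -!mulrA lerD//.
  by rewrite ler_pM2l// addr_gt0.
by rewrite ler_pM2l// addr_gt0// invr_gt0.
Qed.

Lemma absip2_addr0 x u v : absip2 x v <= 0 -> absip2 x (u + v) = absip2 x u.
Proof.
rewrite /absip2 mulJD !(psdDr psd_ip).
move: (ip x v) (ip x (mulJ v)) => p q pq.
have p0 : p = 0 by apply/eqP; rewrite -sqrf_eq0 eq_le sqr_ge0; nra.
have q0 : q = 0 by apply/eqP; rewrite -sqrf_eq0 eq_le sqr_ge0; nra.
by rewrite p0 q0 !addr0.
Qed.

Lemma frame_sum_bessel0 e1 e2 x : bessel (fun i => e2 i - e1 i) 0 ->
  frame_sum e2 x = frame_sum e1 x.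
Proof.
move=> h; apply: eq_esum => i _; congr EFin.
have := le_trans (frame_sum_seq (fun i => e2 i - e1 i) x (l := [:: i]) isT) (h x).
rewrite big_seq1 lee_fin mul0r => /(absip2_addr0 (e1 i)).
by rewrite (addrC (e1 i)) subrK.
Qed.

(** The triangle inequality for the analysis operators, squared: weighting
    [absip2_young] by the ratio [t] of the two norms is optimal, and makes the
    bound the square of the sum of the norms. *)
Lemma bessel_perturb e1 e2 B t : 0 <= t -> bessel e1 B ->
  bessel (fun i => e2 i - e1 i) (B * t ^+ 2) -> bessel e2 (B * (1 + t) ^+ 2).
Proof.
rewrite le_eqVlt => /predU1P[<-|t0] h1 h2.
  rewrite expr0n/= mulr0 in h2 => x.
  by rewrite (frame_sum_bessel0 x h2) addr0 expr1n mulr1.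
have := bessel_sum t0 h1 h2.
rewrite (_ : (fun i => _) = e2); last by apply/funext => i; rewrite addrC subrK.
rewrite (_ : (1 + t) * B + _ = B * (1 + t) ^+ 2)//.
by field; rewrite gt_eqF.
Qed.

Lemma frame_below_perturb e1 e2 A C t : 0 <= t -> t < 1 ->
  frame_below e1 A -> bessel e2 C ->
  bessel (fun i => e2 i - e1 i) (A * t ^+ 2) ->
  frame_below e2 (A * (1 - t) ^+ 2).
Proof.
move=> + t1 h1 h2; rewrite le_eqVlt => /predU1P[<-|t0] h12 x.
  rewrite expr0n/= mulr0 in h12.
  by rewrite (frame_sum_bessel0 x h12) subr0 expr1n mulr1.
have nt : 0 < 1 - t by rewrite subr_gt0.
rewrite -(frame_formE h2) lee_fin.
set y := frame_form e2 x x.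
suff h : (frame_sum e1 x <=
    ((y + (t^-1 - 1) * (A * t ^+ 2 * ip x x)) / (1 - t))%:E)%E.
  have := le_trans (h1 x) h; rewrite lee_fin ler_pdivlMr//.
  rewrite -lerBlDr; apply: le_trans; rewrite le_eqVlt.
  rewrite (_ : A * (1 - t) ^+ 2 * ip x x = A * ip x x * (1 - t) -
    (t^-1 - 1) * (A * t ^+ 2 * ip x x)) ?eqxx//.
  by field; rewrite gt_eqF.
apply: esum_le_seq => [i|l ul]; first by rewrite lee_fin absip2_ge0.
rewrite sumEFin lee_fin ler_pdivlMr// mulrC.
have l2 : \sum_(i <- l) absip2 x (e2 i) <= y.
  by rewrite -lee_fin (frame_formE h2) frame_sum_seq.
have l12 : \sum_(i <- l) absip2 x (e2 i - e1 i) <= A * t ^+ 2 * ip x x.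
  rewrite -lee_fin (le_trans _ (h12 x))//.
  exact: (frame_sum_seq (fun i => e2 i - e1 i)).
(* [1 + tau = 1 / (1 - t)] *)
have tau0 : 0 < t / (1 - t) by rewrite divr_gt0.
have ptw i : (1 - t) * absip2 x (e1 i) <=
    absip2 x (e2 i) + (t^-1 - 1) * absip2 x (e2 i - e1 i).
  have := absip2_young x (e2 i) (- (e2 i - e1 i)) tau0.
  rewrite absip2N opprB addrC subrK -(@ler_pM2l _ (1 - t))//.
  move=> /le_trans; apply; rewrite le_eqVlt.
  rewrite (_ : _ * _ = absip2 x (e2 i) +
    (t^-1 - 1) * absip2 x (e2 i - e1 i)) ?eqxx//.
  by field; rewrite ?gt_eqF.
rewrite mulr_sumr; apply: (@le_trans _ _ (\sum_(i <- l)
    (absip2 x (e2 i) + (t^-1 - 1) * absip2 x (e2 i - e1 i)))).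
  by apply: ler_sum => i _; exact: ptw.
rewrite big_split/= -mulr_sumr lerD// ler_wpM2l//.
by rewrite subr_ge0 ltW// invf_gt1.
Qed.

(** By [bessel_synthesis] the finite sums of the two families with the same
    coefficients differ by less than the lower bound of the first. *)
Lemma lower_bound_perturb e1 e2 A r : 0 <= r -> r < A ->
  bessel (fun i => e1 i - e2 i) r ->
  (forall s N (c : nat -> R[i]) v, bijective s ->
    v = \sum_(k < N) cscal (c k) (e1 (s k)) ->
    A * \sum_(k < N) Normc.normc (c k) ^+ 2 <= ip v v) ->
  exists2 A', 0 < A' & forall s N (c : nat -> R[i]) v, bijective s ->
    v = \sum_(k < N) cscal (c k) (e2 (s k)) ->
    A' * \sum_(k < N) Normc.normc (c k) ^+ 2 <= ip v v.
Proof.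
move=> r0 rA h12 low.
(* a positive Bessel bound, still below [A] *)
pose q := (r + A) / 2.
have A0 : 0 < A by exact: le_lt_trans rA.
have q0 : 0 < q by rewrite divr_gt0// ltr_wpDl.
have qA : q < A by rewrite /q; lra.
have {}h12 : bessel (fun i => e1 i - e2 i) q.
  move=> x; rewrite (le_trans (h12 x))// lee_fin ler_wpM2r//.
    by rewrite (psd_ge0 psd_ip).
  by rewrite /q; lra.
(* chosen so that [(1 + t) * q] is halfway between [q] and [A] *)
pose t := (A - q) / (2 * q).
have t0 : 0 < t by rewrite divr_gt0 ?subr_gt0// mulr_gt0.
exists ((1 + t^-1)^-1 * ((A - q) / 2)).
  by rewrite mulr_gt0 ?invr_gt0 ?addr_gt0 ?invr_gt0// divr_gt0// subr_gt0.
move=> s N c v bs vE; set S := \sum_(k < N) _.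
pose v1 := \sum_(k < N) cscal (c k) (e1 (s k)).
pose v3 := \sum_(k < N) cscal (c k) (e1 (s k) - e2 (s k)).
have e13 : v1 = v + v3.
  rewrite /v1 vE /v3 -big_split/=; apply: eq_bigr => k _.
  by rewrite -cscalDr addrC subrK.
have b3 : ip v3 v3 <= q * S := bessel_synthesis h12 q0 bs erefl.
have b1 : A * S <= ip v1 v1 := low s N c v1 bs erefl.
have yg := psd_young psd_ip v3 v t0.
have : (A - q) / 2 * S <= (1 + t^-1) * ip v v.
  move: b1; rewrite e13 (psd_sqD psd_ip) (psdC psd_ip v v3) => b1.
  have : (1 + t) * ip v3 v3 <= (1 + t) * (q * S).
    by rewrite ler_pM2l// addr_gt0.
  have -> : (1 + t) * (q * S) = (A + q) / 2 * S.
    by rewrite /t; field; rewrite gt_eqF.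
  by move=> ?; lra.
by move=> h; rewrite -mulrA ler_pdivrMl// addr_gt0// invr_gt0.
Qed.

End FramesAndBases.

(** * Trigonometric sums over a period *)

Section TrigonometricSums.
Context {R : realType}.
Local Notation mu := (@lebesgue_measure R).

(** The integral of [f] over every window of length [L] is [D], certified by a
    primitive. In this form it is additive in [f], so that trigonometric sums reduce
    to single waves without any discussion of integrability. *)
Definition window_integral (L : R) (f : R -> R) (D : R) : Prop :=
  continuous f /\ exists2 F : R -> R,
    forall t, is_derive t (1 : R) F (f t) & forall t, F (t + L) - F t = D.

Lemma window_integral0 L : window_integral L (fun=> 0) 0.
Proof.
split; first exact: cst_continuous.
exists (cst 0); first by move=> t; exact: is_derive_cst.
by move=> t; rewrite subrr.
Qed.

Lemma window_integralD L f g D E : window_integral L f D ->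
  window_integral L g E -> window_integral L (fun t => f t + g t) (D + E).
Proof.
move=> [cf [F dF FD]] [cg [G dG GE]]; split.
  by move=> t; apply: cvgD; [exact: cf|exact: cg].
exists (F + G); first by move=> t; exact: is_deriveD.
move=> t; rewrite -(FD t) -(GE t).
by rewrite -[LHS]/(F (t + L) + G (t + L) - (F t + G t)); ring.
Qed.

Lemma window_integral_sum L (I : Type) (s : seq I) (f : I -> R -> R) (D : I -> R) :
  (forall i, window_integral L (f i) (D i)) ->
  window_integral L (fun t => \sum_(i <- s) f i t) (\sum_(i <- s) D i).
Proof.
move=> h; elim: s => [|i s ih].
  rewrite big_nil (_ : (fun t => _) = fun=> 0); first exact: window_integral0.
  by apply/funext => t; rewrite big_nil.
rewrite big_cons (_ : (fun t => _) = fun t => f i t + \sum_(j <- s) f j t).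
  exact: window_integralD.
by apply/funext => t; rewrite big_cons.
Qed.

Lemma cis_periodic (k : int) (x : R) : cis (x + 2 * pi * k%:~R) = cis x.
Proof.
have nat_case (n : nat) y : cis (y + 2 * pi * n%:R) = cis y :> R[i].
  elim: n => [|n ih]; first by rewrite mulr0 addr0.
  rewrite -[RHS]ih.
  have -> : y + 2 * pi * n.+1%:R = y + 2 * pi * n%:R + pi *+ 2.
    by rewrite -mulr_natl -[n.+1]addn1 natrD; ring.
  by rewrite /cis cosD2pi sinD2pi.
case: k => n; first exact: nat_case.
by rewrite NegzE mulrNz mulrN -[LHS](nat_case n.+1 _) subrK.
Qed.

Lemma window_integral_wave (b : R) (k : int) (x y : R) : 0 < b ->
  window_integral b^-1
    (fun t => x * cos (2 * pi * (k%:~R * b) * t) + y * sin (2 * pi * (k%:~R * b) * t))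
    (if k == 0 then x * b^-1 else 0).
Proof.
move=> b0; set w := 2 * pi * (k%:~R * b).
have cw : continuous (fun t : R => w * t).
  by move=> t; apply: cvgMl_tmp; exact: cvg_id.
split.
  move=> t; apply: cvgD; apply: cvgMl_tmp.
    by apply: (@continuous_comp _ _ _ (fun t : R => w * t)); [exact: cw|exact: continuous_cos].
  by apply: (@continuous_comp _ _ _ (fun t : R => w * t)); [exact: cw|exact: continuous_sin].
have [k0|k0] := eqVneq k 0.
  have w0 : w = 0 by rewrite /w k0 mul0r mulr0.
  exists (fun t => x * t).
    move=> t; rewrite w0 mul0r cos0 sin0 mulr0 addr0 mulr1.
    have := is_deriveZ x (is_derive_id t (1 : R)).
    by rewrite /GRing.scale/= mulr1.
  by move=> t; rewrite mulrDr; ring.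
have w0 : w != 0.
  by rewrite /w !mulf_eq0 intr_eq0 (negbTE k0) pnatr_eq0 (gt_eqF (pi_gt0 R)) (gt_eqF b0).
have dw t : is_derive t (1 : R) (fun t => w * t) w.
  have := is_deriveZ w (is_derive_id t (1 : R)).
  by rewrite /GRing.scale/= mulr1.
exists (fun t => (x * w^-1) * sin (w * t) + (- (y * w^-1)) * cos (w * t)).
  move=> t.
  have d1 := is_deriveZ (x * w^-1) (is_derive1_comp (is_derive_sin (w * t)) (dw t)).
  have d2 := is_deriveZ (- (y * w^-1)) (is_derive1_comp (is_derive_cos (w * t)) (dw t)).
  apply: (is_derive_eq (is_deriveD d1 d2)).
  by rewrite /GRing.scale/=; field.
move=> t; rewrite mulrDr (_ : w * b^-1 = 2 * pi * k%:~R); last first.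
  by rewrite /w; field; rewrite gt_eqF.
have := cis_periodic k (w * t) => -[-> ->]; ring.
Qed.

Lemma window_integralE (L : R) (f : R -> R) (D al : R) : 0 < L -> (forall t, 0 <= f t) ->
  window_integral L f D -> (\int[mu]_(t in `[al, (al + L)%R]) (f t)%:E = D%:E)%E.
Proof.
move=> L0 f0 [cf [F dF FD]].
have cF : continuous F.
  by move=> t; apply: differentiable_continuous; apply/derivable1_diffP; have [] := dF t.
rewrite (@continuous_FTC2 _ f F)//.
- by rewrite -EFinB FD.
- by rewrite ltrDl.
- exact: continuous_subspaceT.
- split; first by move=> t _; have [] := dF t.
  + by apply: cvg_at_right_filter; exact: cF.
  + by apply: cvg_at_left_filter; exact: cF.
- by move=> t _; rewrite derive1E; exact: derive_val.
Qed.

Definition trigsum (b : R) (s : seq int) (c : int -> R[i]) (t : R) : R[i] :=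
  \sum_(m <- s) c m * cis (2 * pi * (m%:~R * b) * t).

Lemma cRe_sum (I : Type) (s : seq I) (F : I -> R[i]) :
  cRe (\sum_(i <- s) F i) = \sum_(i <- s) cRe (F i).
Proof. by elim: s => [|i s ih]; rewrite ?big_nil// !big_cons cReD ih. Qed.

Lemma cIm_sum (I : Type) (s : seq I) (F : I -> R[i]) :
  cIm (\sum_(i <- s) F i) = \sum_(i <- s) cIm (F i).
Proof. by elim: s => [|i s ih]; rewrite ?big_nil// !big_cons cImD ih. Qed.

(** Parseval's identity. *)
Lemma window_integral_trigsum b s c : 0 < b -> uniq s ->
  window_integral b^-1 (sqmod (trigsum b s c))
    (b^-1 * \sum_(m <- s) Normc.normc (c m) ^+ 2).
Proof.
move=> b0 us.
pose x m n := cRe (c m) * cRe (c n) + cIm (c m) * cIm (c n).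
pose y m n := cRe (c m) * cIm (c n) - cIm (c m) * cRe (c n).
have -> : sqmod (trigsum b s c) = (fun t => \sum_(m <- s) \sum_(n <- s)
    (x m n * cos (2 * pi * ((m - n)%:~R * b) * t) +
     y m n * sin (2 * pi * ((m - n)%:~R * b) * t))).
  apply/funext => t; rewrite /sqmod cRe_sum cIm_sum !expr2 !big_distrlr/=.
  rewrite -big_split/=; apply: eq_bigr => m _.
  rewrite -big_split/=; apply: eq_bigr => n _.
  rewrite intrB mulrBl !(mulrBr (2 * pi)) mulrBl cosB sinB !cReM !cImM /x /y /=.
  ring.
have -> : b^-1 * \sum_(m <- s) Normc.normc (c m) ^+ 2 =
    \sum_(m <- s) \sum_(n <- s) (if m - n == 0 then x m n * b^-1 else 0).
  rewrite mulr_sumr !big_seq; apply: eq_bigr => m ms.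
  rewrite (bigD1_seq m)//= subrr eqxx big1 => [|n nm]; last first.
    by rewrite subr_eq0 eq_sym (negbTE nm).
  by rewrite addr0 normc_sq /x !expr2 mulrC.
apply: window_integral_sum => m; apply: window_integral_sum => n.
exact: window_integral_wave.
Qed.

Lemma trigsum_integral_le b s c al be : 0 < b -> uniq s -> be <= al + b^-1 ->
  (\int[mu]_(t in `[al, be[) (sqmod (trigsum b s c) t)%:E <=
   (b^-1 * \sum_(m <- s) Normc.normc (c m) ^+ 2)%:E)%E.
Proof.
move=> b0 us abe; have w := window_integral_trigsum c b0 us.
have Li : 0 < b^-1 by rewrite invr_gt0.
rewrite -(window_integralE al Li (sqmod_ge0 _) w).
apply: ge0_subset_integral => //.
- apply/measurable_EFinP/measurable_funTS.
  by apply: continuous_measurable_fun; case: w.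
- by move=> t _; rewrite lee_fin sqmod_ge0.
- move=> t /=; rewrite !in_itv/= => /andP[-> tb]/=.
  by rewrite (le_trans (ltW tb)).
Qed.

End TrigonometricSums.

(** * Cells *)

Section Cells.
Context {R : realType}.
Local Notation mu := (@lebesgue_measure R).

Definition cell (a : R) (j : int) : set R := `[j%:~R * a, (j + 1)%:~R * a[%classic.

Lemma cellE a j t : 0 < a -> cell a j t <-> Num.floor (t / a) = j.
Proof.
move=> a0; rewrite /cell/= in_itv/= -ler_pdivlMr// -ltr_pdivrMr//.
split=> [h|<-]; first by apply/eqP; rewrite floor_eq.
by rewrite ge_floor/= lt_succ_floor.
Qed.

Lemma measurable_cell a j : measurable (cell a j).
Proof. exact: measurable_itv. Qed.

Lemma integral_cells a (f : R -> \bar R) : 0 < a -> measurable_fun setT f ->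
  (forall t, 0 <= f t)%E ->
  (\int[mu]_t f t = \esum_(j in [set: int]) \int[mu]_(t in cell a j) f t)%E.
Proof.
move=> a0 mf f0; have [s bs] := enum_int.
rewrite (esum_nneseries _ bs); last by move=> j; exact: integral_ge0.
have cov : [set: R] = \bigcup_k cell a (s k).
  apply/seteqP; split => // t _; have [s' sK s'K] := bs.
  by exists (s' (Num.floor (t / a))) => //; apply/cellE.
rewrite [in LHS]cov ge0_integral_bigcup//.
- by move=> k; exact: measurable_cell.
- by rewrite -cov.
- move=> i j _ _ [t [/(cellE _ _ a0) h1 /(cellE _ _ a0) h2]].
  by apply: (bij_inj bs); rewrite -h1 -h2.
Qed.

Lemma cell_shift a j n (t : R) : cell a (j + n) t <-> cell a j (t - n%:~R * a).
Proof.
rewrite /cell/= !in_itv/= lerBrDr ltrBlDr -!mulrDl -!intrD.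
by rewrite addrAC.
Qed.

Lemma integral_cell_shift a j n (f : R -> \bar R) : measurable_fun setT f ->
  (forall t, 0 <= f t)%E ->
  (\int[mu]_(t in cell a (j + n)) f (t - n%:~R * a)%R =
   \int[mu]_(t in cell a j) f t)%E.
Proof.
move=> mf f0; rewrite -(ge0_integral_shift (n%:~R * a) (measurable_cell a j))//.
- by congr (integral _ _ _); apply/seteqP; split => t /cell_shift.
- exact: measurable_funTS.
Qed.

Lemma esum_pair_le (a : int * int -> \bar R) (G : int -> \bar R) :
  (forall i, 0 <= a i)%E ->
  (forall n (s : seq int), uniq s -> (\sum_(m <- s) a (m, n) <= G n)%E) ->
  (\esum_(i in [set: int * int]) a i <= \esum_(n in [set: int]) G n)%E.
Proof.
move=> a0 h.
rewrite (_ : (\esum_(i in [set: int * int]) a i =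
  \esum_(n in [set: int]) \esum_(m in [set: int]) a (m, n))%E).
  apply: le_esum => n _; apply: esum_le_seq => // s us; exact: h.
rewrite (esum_esum (a := fun n m => a (m, n)))//.
rewrite (@reindex_esum _ _ _ (setT `*`` fun=> setT) setT (fun k => (k.2, k.1)))//.
split=> //; first by move=> [m n] [m' n'] _ _ [-> ->].
by move=> [m n] _; exists (n, m).
Qed.

End Cells.

(** * Gabor systems, one translate at a time *)

Section Gabor.
Context {R : realType}.
Local Notation mu := (@lebesgue_measure R).
Local Notation V := (@L2V R).
Implicit Types (u v w x y f : V) (a b : R).

Definition gabor a b v (i : int * int) : V :=
  shiftop (i.1%:~R * b) (i.2%:~R * a) v.

Lemma WH_gabor a b v : WH_system (cfun v) a b = (fun i => cfun (gabor a b v i)).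
Proof. by apply/funext => i; rewrite WH_systemE. Qed.

Lemma ip_coef f u : ip f (cscal (coef f u) u) = absip2 f u.
Proof. by rewrite ip_cscalr /absip2 !expr2. Qed.

(** The combination of the modulates of [v] whose coefficients are those of
    [f]: its product with [f] is the sum of squares to be bounded. *)
Lemma gabor_row a b v f n (s : seq int) : exists2 K : V,
  ip f K = \sum_(m <- s) absip2 f (gabor a b v (m, n)) &
  forall t, cfun K t =
    trigsum b s (fun m => coef f (gabor a b v (m, n))) t * cfun v (t - n%:~R * a).
Proof.
exists (\sum_(m <- s) cscal (coef f (gabor a b v (m, n))) (gabor a b v (m, n))).
  rewrite (psdC psd_ip) (psd_suml psd_ip); apply: eq_bigr => m _.
  by rewrite (psdC psd_ip) ip_coef.
move=> t; rewrite /trigsum; elim: s => [|m s ih].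
  by rewrite !big_nil mul0r -(scale0r 0) cfunZ mul0r.
rewrite !big_cons [LHS]cfunD ih [RHS]mulrDl; congr (_ + _).
by rewrite cfun_cscal cfun_shiftop modulateE /translate/= mulrA.
Qed.

(** Cauchy-Schwarz in the plane, under the integral. *)
Lemma ip_le_integral f u (G : R -> \bar R) : measurable_fun setT G ->
  (forall t, 0 <= G t)%E ->
  (\forall t \ae mu, ((2 * Num.sqrt (sqmod (cfun f) t * sqmod (cfun u) t))%:E <= G t)%E) ->
  ((2 * ip f u)%:E <= \int[mu]_t G t)%E.
Proof.
move=> mG G0 h.
have int := ipf_integrable (L2_cfun f) (L2_cfun u).
have int2 := integrableZl measurableT 2 int.
have e : (2 * ip f u)%:E = (\int[mu]_t (2%:E *
    (cRe (cfun f t) * cRe (cfun u t) + cIm (cfun f t) * cIm (cfun u t))%:E))%E.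
  rewrite integralZl// EFinM; congr (_ * _)%E.
  by rewrite [ip f u]/(fine _) fineK// integrable_fin_num.
rewrite e (le_trans (lee_abs _))// (le_trans (le_abse_integral _ _ _))//.
  exact: measurable_int int2.
apply: ae_ge0_le_integral => //.
  by apply: measurableT_comp => //; exact: measurable_int int2.
apply: (@filterS _ _ (ae_filter_ringOfSetsType mu) _ _ _ h) => t + _.
apply: le_trans.
rewrite -EFinM abse_EFin lee_fin normrM ger0_norm// ler_pM2l//.
rewrite -sqrtr_sqr ler_wsqrtr// /sqmod.
move: (cRe _) (cIm _) (cRe _) (cIm _) => p q p' q'.
rewrite -subr_ge0 (_ : _ - _ = (p * q' - q * p') ^+ 2) ?sqr_ge0//.
by ring.
Qed.

End Gabor.

(** * A frame has redundancy at most the ratio of its bounds *)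

Section Density.
Context {R : realType}.
Local Notation mu := (@lebesgue_measure R).
Local Notation V := (@L2V R).
Implicit Types (u v w x y f : V) (a b : R).

Lemma sqrt_amgm (p q l : R) : 0 < l -> 0 <= p -> 0 <= q ->
  2 * Num.sqrt (p * q) <= l * p + l^-1 * q.
Proof.
move=> l0 p0 q0; have li : 0 < l^-1 by rewrite invr_gt0.
have s0 : 0 <= l * p + l^-1 * q by rewrite addr_ge0// mulr_ge0// ltW.
rewrite -(@ler_pXn2r _ 2)// ?nnegrE ?mulr_ge0 ?sqrtr_ge0//.
rewrite exprMn sqr_sqrtr ?mulr_ge0// -subr_ge0.
rewrite (_ : _ - _ = (l * p - l^-1 * q) ^+ 2) ?sqr_ge0//.
by field; rewrite gt_eqF.
Qed.

Lemma sqmodM (F G : R -> R[i]) t :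
  sqmod (fun t => F t * G t) t = sqmod F t * sqmod G t.
Proof. by rewrite /sqmod cReM cImM; ring. Qed.

Lemma measurable_sqmod_cfun v : measurable_fun setT (sqmod (cfun v)).
Proof. by apply: measurable_sqmod; have [] := L2_cfun v. Qed.

Lemma measurable_sqmod_trigsum b s c : 0 < b -> uniq s ->
  measurable_fun setT (sqmod (@trigsum R b s c)).
Proof.
move=> b0 us; apply: continuous_measurable_fun.
by case: (window_integral_trigsum c b0 us).
Qed.

Lemma int_sqmod_cfun v : (\int[mu]_t (sqmod (cfun v) t)%:E)%E = (ip v v)%:E.
Proof. by rewrite int_sqmod//; exact: L2_cfun. Qed.

Definition indicator (al be : R) : V := toL2 (fun t => (\1_(`[al, be[ : set R) t)%:C)%C.

Lemma sqmod_indicator al be t : sqmod (cfun (indicator al be)) t =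
  \1_(`[al, be[ : set R) t.
Proof.
have mI : measurable (`[al, be[ : set R) by exact: measurable_itv.
have e z : sqmod (fun t => (\1_(`[al, be[ : set R) t)%:C)%C z =
    \1_(`[al, be[ : set R) z.
  by rewrite /sqmod/= expr0n/= addr0 indicE; case: (_ \in _); rewrite ?expr1n ?expr0n.
rewrite toL2K ?e//; apply/L2E; split.
- exact: measurable_indic.
- exact: measurable_cst.
- under eq_integral do rewrite e.
  by rewrite integral_indic// setIT/= lebesgue_measure_itv/=; case: ifP; rewrite ltry.
Qed.

Lemma ip_indicator al be : al <= be ->
  ip (indicator al be) (indicator al be) = be - al.
Proof.
move=> ab; apply: EFin_inj; rewrite -int_sqmod_cfun.
under eq_integral do rewrite sqmod_indicator.
rewrite integral_indic ?setIT//.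
rewrite /= lebesgue_measure_itv/= lte_fin; move: ab; rewrite le_eqVlt => /predU1P[->|->//].
by rewrite ltxx subrr.
Qed.

(** Bessel's inequality for the exponentials on a window of length at most
    [1 / b], read on the coefficients of the indicator of that window. *)
Lemma gabor_row_indicator a b v n (s : seq int) al be : 0 < b -> uniq s ->
  be <= al + b^-1 ->
  ((\sum_(m <- s) absip2 (indicator al be) (gabor a b v (m, n)))%:E <=
   \int[mu]_(t in `[al, be[) (b^-1 * sqmod (cfun v) (t - n%:~R * a))%:E)%E.
Proof.
move=> b0 us abe; set f := indicator al be.
have [K fK Kt] := gabor_row a b v f n s.
set c := (fun m => coef f (gabor a b v (m, n))) in Kt.
set C := \sum_(m <- s) _ in fK *.
set X := (X in (_ <= X)%E).
have CE : \sum_(m <- s) Normc.normc (c m) ^+ 2 = C.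
  by apply: eq_bigr => m _; rewrite normc_sq.
pose P t := (b * sqmod (trigsum b s c) t)%:E : \bar R.
pose W t := (b^-1 * sqmod (cfun v) (t - n%:~R * a))%:E : \bar R.
have P0 t : (0 <= P t)%E by rewrite lee_fin mulr_ge0 ?sqmod_ge0 ?ltW.
have bi : 0 < b^-1 by rewrite invr_gt0.
have W0 t : (0 <= W t)%E by rewrite lee_fin mulr_ge0 ?sqmod_ge0 ?(ltW bi).
have mP : measurable_fun setT P.
  by apply/measurable_EFinP/measurable_funM => //; exact: measurable_sqmod_trigsum.
have mW : measurable_fun setT W.
  apply/measurable_EFinP/measurable_funM => //.
  exact: measurable_translate (measurable_sqmod_cfun v).
have mJ : measurable (`[al, be[ : set R) by exact: measurable_itv.
pose J : set R := `[al, be[%classic.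
have h : ((2 * ip f K)%:E <= \int[mu]_t ((fun t => P t + W t)%E \_ J) t)%E.
  apply: ip_le_integral.
  - apply/(measurable_restrictT _ mJ); apply: emeasurable_funD; exact: measurable_funTS.
  - by move=> t; rewrite /patch; case: ifP => // _; rewrite adde_ge0.
  - apply: aeW => t; rewrite sqmod_indicator /patch indicE.
    case: (t \in J); last by rewrite mul0r sqrtr0 mulr0.
    have -> : sqmod (cfun K) t =
        sqmod (trigsum b s c) t * sqmod (cfun v) (t - n%:~R * a).
      rewrite -[RHS](sqmodM _ (fun t => cfun v (t - n%:~R * a))).
      by rewrite /sqmod Kt.
    rewrite mul1r -EFinD lee_fin; apply: sqrt_amgm => //; exact: sqmod_ge0.
rewrite -integral_mkcond ge0_integralD// in h; last 2 first.
  exact: measurable_funTS.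
  exact: measurable_funTS.
have hP : (\int[mu]_(t in J) P t <= C%:E)%E.
  rewrite /P; under eq_integral do rewrite EFinM.
  rewrite ge0_integralZl_EFin ?(ltW b0)//; last 2 first.
  - by move=> t _; rewrite lee_fin sqmod_ge0.
  - by apply/measurable_EFinP/measurable_funTS; exact: measurable_sqmod_trigsum.
  have := trigsum_integral_le c b0 us abe; rewrite CE => h1.
  apply: (@le_trans _ _ (b%:E * (b^-1 * C)%:E)%E); first by rewrite lee_pmul2l.
  by rewrite -EFinM mulrA mulfV ?mul1r// gt_eqF.
have : (C%:E + C%:E <= C%:E + X)%E.
  rewrite -EFinD (_ : C + C = 2 * ip f K); last by rewrite fK; ring.
  by apply: le_trans h _; apply: leeD.
by rewrite leeD2lE.
Qed.

Lemma gabor_below_window a b v A al be : 0 < b -> al <= be -> be <= al + b^-1 ->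
  frame_below (gabor a b v) A ->
  ((A * (be - al))%:E <= \esum_(n in [set: int])
    \int[mu]_(t in `[al, be[) (b^-1 * sqmod (cfun v) (t - n%:~R * a))%:E)%E.
Proof.
move=> b0 ab abe hA; have := hA (indicator al be); rewrite ip_indicator//.
move=> /le_trans; apply; apply: esum_pair_le => [i|n s us].
  by rewrite lee_fin absip2_ge0.
by rewrite sumEFin gabor_row_indicator.
Qed.

(** Cut a period [[0, a[] into pieces not longer than [1 / b], and add the lower
    frame inequalities for their indicators: the translates of [v] by multiples of
    [a], restricted to one period, reassemble [v]. *)
Lemma gabor_below_period a b v A : 0 < a -> 0 < b ->
  frame_below (gabor a b v) A -> A * a <= b^-1 * ip v v.
Proof.
move=> a0 b0 hA; have bi : 0 < b^-1 by rewrite invr_gt0.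
pose W n t := (b^-1 * sqmod (cfun v) (t - n%:~R * a))%:E : \bar R.
have W0 n t : (0 <= W n t)%E by rewrite lee_fin mulr_ge0 ?sqmod_ge0 ?(ltW bi).
have mW n : measurable_fun setT (W n).
  apply/measurable_EFinP/measurable_funM => //.
  exact: measurable_translate (measurable_sqmod_cfun v).
have [N Nab] : exists N : nat, a * b < N.+1%:R.
  exists (Num.trunc (a * b)); exact: truncnS_gt.
pose de := a / N.+1%:R.
have N0 : 0 < N.+1%:R :> R by rewrite ltr0n.
have de0 : 0 <= de by rewrite divr_ge0 ?ltW.
have deb : de <= b^-1.
  by rewrite /de ler_pdivrMr// mulrC ler_pdivlMr// ltW.
have step k : ((A * (k%:R * de))%:E <= \esum_(n in [set: int])
    \int[mu]_(t in `[0%R, (k%:R * de)%R[) W n t)%E.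
  elim: k => [|k ih].
    by rewrite mul0r mulr0; apply: esum_ge0 => n _; exact: integral_ge0.
  have kde : 0 <= k%:R * de by rewrite mulr_ge0.
  have kk : k%:R * de <= k.+1%:R * de by rewrite ler_wpM2r// ler_nat.
  have e : k.+1%:R * de - k%:R * de = de by rewrite -natr1; ring.
  have hk : k.+1%:R * de <= k%:R * de + b^-1 by rewrite -lerBlDl e.
  have := leeD ih (gabor_below_window b0 kk hk hA).
  rewrite -EFinD -mulrDr e [k%:R * de + de](_ : _ = k.+1%:R * de); last first.
    by rewrite -natr1; ring.
  move=> /le_trans; apply; rewrite -esumD//; last 2 first.
  - by move=> n _; apply: integral_ge0 => t _; exact: W0.
  - by move=> n _; apply: integral_ge0 => t _; exact: W0.
  apply: le_esum => n _; rewrite -ge0_integral_setU//=.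
  - have -> : (`[0%R, (k%:R * de)%R[ `|` `[(k%:R * de)%R, (k.+1%:R * de)%R[ =
        `[0%R, (k.+1%:R * de)%R[ :> set R)%classic.
      by rewrite -itv_bndbnd_setU// bnd_simp.
    by [].
  - exact: measurable_funTS (mW n).
  - apply/disj_setPS => t /= [] ; rewrite !in_itv/= => /andP[_ h1] /andP[h2 _].
    by have := lt_le_trans h1 h2; rewrite ltxx.
have h := step N.+1.
have e : N.+1%:R * de = a by rewrite /de mulrC mulfVK// gt_eqF.
rewrite e in h.
rewrite -lee_fin; apply: le_trans h _.
rewrite EFinM -int_sqmod_cfun -ge0_integralZl_EFin ?(ltW bi)//; last 2 first.
- by move=> t _; rewrite lee_fin sqmod_ge0.
- by apply/measurable_EFinP; exact: measurable_sqmod_cfun.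
rewrite (integral_cells a0); last 2 first.
- by apply: measurable_funeM; apply/measurable_EFinP; exact: measurable_sqmod_cfun.
- by move=> t; rewrite -EFinM lee_fin mulr_ge0 ?sqmod_ge0 ?(ltW bi).
rewrite [leRHS](@reindex_esum _ _ _ setT setT (fun n : int => - n)); last first.
  by rewrite setTT_bijective; exists (fun n : int => - n); exact: opprK.
apply: le_esum => n _.
rewrite -(@integral_cell_shift _ a (- n) n); last 2 first.
- by apply: measurable_funeM; apply/measurable_EFinP; exact: measurable_sqmod_cfun.
- by move=> t; rewrite -EFinM lee_fin mulr_ge0 ?sqmod_ge0 ?(ltW bi).
rewrite addNr le_eqVlt; apply/orP; left; apply/eqP; congr (integral _ _ _).
by rewrite /cell mul0r add0r mul1r.
Qed.

(** An element of a Bessel family has squared norm at most the bound: test the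
    inequality on that element. *)
Lemma gabor_norm_le a b v B : 0 < B -> bessel (gabor a b v) B -> ip v v <= B.
Proof.
move=> B0 hB.
have e : gabor a b v (0, 0) = v.
  apply: cfun_inj; rewrite cfun_shiftop !mul0r; apply/funext => t.
  by rewrite modulateE /translate mulr0 mul0r cis0 mul1r subr0.
have := le_trans (frame_sum_seq (gabor a b v) v (l := [:: (0, 0)]) isT) (hB v).
rewrite big_seq1 e lee_fin => h.
have {h} : ip v v * ip v v <= B * ip v v.
  by apply: le_trans h; rewrite /absip2 expr2 lerDl sqr_ge0.
have [v0|v0] := leP (ip v v) 0; first by move=> _; exact: le_trans v0 (ltW B0).
by rewrite ler_pM2r.
Qed.

Lemma gabor_redundancy a b v A B : 0 < a -> 0 < b -> 0 < B ->
  frame_below (gabor a b v) A -> bessel (gabor a b v) B -> A * (a * b) <= B.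
Proof.
move=> a0 b0 B0 hA hB; have h1 := gabor_below_period a0 b0 hA.
have h2 := gabor_norm_le B0 hB.
rewrite mulrA -ler_pdivlMr//; apply: le_trans h1 _.
by rewrite mulrC ler_pM2r// invr_gt0.
Qed.

End Density.

(** * The density theorem *)

Section DensityTheorem.
Context {R : realType}.
Local Notation V := (@L2V R).
Implicit Types (u v w x y f : V) (a b : R).

Lemma frame_sum_shiftop a b v (m n : int) x :
  frame_sum (gabor a b v) (shiftop (m%:~R * b) (n%:~R * a) x) =
  frame_sum (gabor a b v) x.
Proof.
rewrite /frame_sum [RHS](@reindex_esum _ _ _ setT setT
  (fun i : int * int => (i.1 - m, i.2 - n))); last first.
  rewrite setTT_bijective; exists (fun i : int * int => (i.1 + m, i.2 + n)).
    by move=> [k l]/=; rewrite !subrK.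
  by move=> [k l]/=; rewrite !addrK.
by apply: eq_esum => i _; rewrite /gabor absip2_shiftop_shift/= !intrB !mulrBl.
Qed.

Lemma frame_sum_mulJ e x : frame_sum e (mulJ x) = frame_sum e x.
Proof.
apply: eq_esum => i _; congr EFin.
by rewrite /absip2 ip_mulJ ip_mulJl sqrrN addrC.
Qed.

Section FrameOperator.
Context {a b : R} {v : V} (hB : bessel (gabor a b v) 1).
Local Notation D := (frame_form (gabor a b v)).

Lemma frame_form_invariant (U : V -> V) :
  (forall x y, U (x + y) = U x + U y) -> (forall k x, U (k *: x) = k *: U x) ->
  (forall x, frame_sum (gabor a b v) (U x) = frame_sum (gabor a b v) x) ->
  forall x y, D (U x) (U y) = D x y.
Proof.
move=> UD UZ UQ x y; rewrite /frame_form /polar.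
have UB : U x - U y = U (x - y) by rewrite -(scaleN1r y) UD UZ scaleN1r.
by rewrite UB -UD !UQ.
Qed.

Context {S : V -> V} (hS : forall x y, ip (S x) y = D x y).

(** The frame operator commutes with every surjective isometry which preserves
    its quadratic form. *)
Lemma frame_op_commute (U : V -> V) :
  (forall x y, ip (U x) (U y) = ip x y) -> (forall x, exists y, U y = x) ->
  (forall x y, D (U x) (U y) = D x y) ->
  forall x, ip x (U (S v)) = ip (S x) (U v).
Proof.
move=> Ui Us UD x; have [x0 <-] := Us x.
by rewrite Ui hS UD (psdC psd_ip) hS (psdC (psd_frame_form hB)).
Qed.

(** [(3 - S) / 2] is one step, from [1], of Newton's iteration for the inverse
    square root of [S]. *)
Definition newton x := (3 / 2) *: x - 2^-1 *: S x.

Lemma ip_newton (U : V -> V) :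
  (forall x y, U (x + y) = U x + U y) -> (forall k x, U (k *: x) = k *: U x) ->
  (forall x y, ip (U x) (U y) = ip x y) -> (forall x, exists y, U y = x) ->
  (forall x, frame_sum (gabor a b v) (U x) = frame_sum (gabor a b v) x) ->
  forall x, ip x (U (newton v)) = ip (newton x) (U v).
Proof.
move=> UD UZ Ui Us UQ x.
have h := frame_op_commute Ui Us (frame_form_invariant UD UZ UQ) x.
rewrite /newton UD -scaleNr UZ UZ (psdDr psd_ip) !(psdZr psd_ip) h.
by rewrite -scaleNr (psdDl psd_ip) !(psdZl psd_ip).
Qed.

Lemma mulJZ k x : mulJ (k *: x) = k *: mulJ x.
Proof.
apply: cfun_inj; apply/funext => t.
by rewrite cfunJ cfunZ [RHS]cfunZ cfunJ mulrCA.
Qed.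

Lemma mulJ_surj x : exists y, mulJ y = x.
Proof. by exists (x.2, - x.1); case: x => x1 x2; rewrite /mulJ/= opprK. Qed.

(** The analysis operator of the new window is that of [v] composed with
    [(3 - S) / 2]. *)
Lemma absip2_newton x i :
  absip2 x (gabor a b (newton v) i) = absip2 (newton x) (gabor a b v i).
Proof.
rewrite /absip2 /gabor; set c := _ * b; set d := _ * a.
rewrite (ip_newton (U := shiftop c d)).
- rewrite (ip_newton (U := mulJ \o shiftop c d))//=.
  + by move=> y z; rewrite shiftopD mulJD.
  + by move=> k y; rewrite shiftopZ mulJZ.
  + by move=> y z; rewrite ip_mulJ ip_shiftop.
  + move=> y; have [z <-] := mulJ_surj y; have [w <-] := shiftop_surj c d z.
    by exists w.
  + by move=> y; rewrite frame_sum_mulJ frame_sum_shiftop.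
- exact: shiftopD.
- exact: shiftopZ.
- exact: ip_shiftop.
- exact: shiftop_surj.
- by move=> y; exact: frame_sum_shiftop.
Qed.

Lemma frame_form_newton x : let y := x - S x in
  D (newton x) (newton x) = ip x x - ip y y + 4^-1 * D y y.
Proof.
move=> y; have fD := psd_frame_form hB.
have nE : newton x = x + 2^-1 *: y.
  have half : (3 / 2) *: x = x + 2^-1 *: x.
    rewrite -[X in X + _](scale1r x) -scalerDl; congr (_ *: _).
    by field.
  by rewrite /newton /y half scalerBr addrA.
rewrite nE (psd_sqD fD) (psdZr fD) (psdZl fD) (psdZr fD).
have e1 : D x x = ip x x - ip x y.
  by rewrite -hS /y (psdDr psd_ip) (psdNr psd_ip) (psdC psd_ip (S x)); ring.
have e2 : D x y = ip x y - ip y y.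
  by rewrite -hS {3}/y (psdDl psd_ip) (psdNl psd_ip); ring.
by rewrite e1 e2; field.
Qed.

End FrameOperator.

(** With [Y = 1 - S] the frame operator of the new window is
    [1 - (3 Y^2 + Y^3) / 4]; since [0 <= Y <= 1] it lies between [1 - Y^2] and [1],
    and [Y <= d]. *)
Lemma gabor_improve a b v d : 0 < d -> bessel (gabor a b v) 1 ->
  frame_below (gabor a b v) (1 - d) ->
  exists v', bessel (gabor a b v') 1 /\ frame_below (gabor a b v') (1 - d ^+ 2).
Proof.
move=> d0 hB hA; pose D := frame_form (gabor a b v).
have fD : psd_form D := psd_frame_form hB.
have D1 x : D x x <= ip x x by have := frame_form_le hB x; rewrite mul1r.
have Dd x : (1 - d) * ip x x <= D x x by exact: (frame_form_ge hB).
have /choice[S hS] : forall x, exists w, forall y, ip w y = D x y.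
  apply: (lax_milgram complete_ip psd_ip fD ltr01 ltr01 _ (B := 1)) => x.
  - by rewrite mul1r.
  - by rewrite mul1r.
  - by rewrite mul1r.
have sumE x : frame_sum (gabor a b (newton (S := S) v)) x =
    (ip x x - ip (x - S x) (x - S x) + 4^-1 * D (x - S x) (x - S x))%:E.
  have h := frame_form_newton hB hS x; rewrite -h (frame_formE hB).
  by apply: eq_esum => i _; rewrite (absip2_newton hB hS).
exists (newton (S := S) v); split=> x; rewrite sumE lee_fin.
- move: (x - S x) => y.
  by have := D1 y; have := psd_ge0 psd_ip y; lra.
- set y := x - S x.
  have Dy := psd_ge0 fD y.
  have fE := psd_formB psd_ip fD D1.
  have Ey z : ip y z = ip x z - D x z.
    by rewrite /y (psdDl psd_ip) (psdNl psd_ip) hS.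
  have h := psd_young fE x y d0; rewrite -Ey in h.
  have h1 : d * (ip x x - D x x) <= d * (d * ip x x).
    by rewrite ler_pM2l//; have := Dd x; lra.
  have h2 : d^-1 * (ip y y - D y y) <= ip y y.
    by rewrite ler_pdivrMl//; have := Dd y; lra.
  by rewrite expr2; lra.
Qed.

Lemma frame_sumZ a b v k x : 0 < k ->
  frame_sum (gabor a b (Num.sqrt k *: v)) x = (k%:E * frame_sum (gabor a b v) x)%E.
Proof.
move=> k0; have e i : absip2 x (gabor a b (Num.sqrt k *: v) i) =
    k * absip2 x (gabor a b v i).
  rewrite /absip2 /gabor shiftopZ mulJZ !(psdZr psd_ip) !exprMn sqr_sqrtr ?ltW//.
  by rewrite mulrDr.
have [s bs] := enum_int2.
rewrite /frame_sum -(esumZl bs) ?(ltW k0)//; last first.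
  by move=> i; rewrite lee_fin absip2_ge0.
by apply: eq_esum => i _; rewrite e EFinM.
Qed.

(** [gabor_redundancy] for the iterates of [gabor_improve], whose bounds tend
    to a common value. *)
Theorem gabor_density a b v A B : 0 < a -> 0 < b -> 0 < A -> 0 < B ->
  frame_below (gabor a b v) A -> bessel (gabor a b v) B -> a * b <= 1.
Proof.
move=> a0 b0 A0 B0 hA hB.
have ip0 x : 0 <= ip x x by exact: psd_ge0 psd_ip _.
(* [2^-1] keeps [d] positive, as [gabor_improve] requires, even if [1 - A / B] is not *)
pose d := Num.max (1 - A / B) 2^-1.
have d0 : 0 < d by rewrite lt_max invr_gt0 ltr0n orbT.
have d1 : d < 1.
  rewrite gt_max ltrBlDr ltrDl divr_gt0//= invf_lt1// ltr1n //.
have start : exists v', bessel (gabor a b v') 1 /\ frame_below (gabor a b v') (1 - d).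
  exists (Num.sqrt B^-1 *: v); split=> x; rewrite frame_sumZ ?invr_gt0//.
    apply: (@le_trans _ _ (B^-1%:E * (B * ip x x)%:E)%E).
      by rewrite lee_pmul2l ?lte_fin ?invr_gt0.
    by rewrite -EFinM mulrA mulVf ?gt_eqF.
  apply: (@le_trans _ _ (B^-1%:E * (A * ip x x)%:E)%E); last first.
    by rewrite lee_pmul2l ?lte_fin ?invr_gt0.
  rewrite -EFinM lee_fin mulrA ler_wpM2r// lerBlDr -lerBlDl mulrC.
  by rewrite le_max lexx.
have iter n : exists v', bessel (gabor a b v') 1 /\
    frame_below (gabor a b v') (1 - d ^+ n.+1).
  elim: n => [|n [w [wB wA]]]; first by rewrite expr1.
  have dn0 : 0 < d ^+ n.+1 by rewrite exprn_gt0.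
  have [w' [w'B w'A]] := gabor_improve dn0 wB wA.
  exists w'; split; first exact: w'B.
  move=> x; apply: le_trans (w'A x).
  rewrite lee_fin ler_wpM2r// lerD2l lerN2 expr2.
  rewrite (exprS d n.+1) ler_pM2r// exprS ler_piMr ?(ltW d0)//.
  by rewrite exprn_ile1 ?(ltW d0) ?(ltW d1).
have lim : (1 - d ^+ n.+1) * (a * b) @[n --> \oo] --> (1 - 0) * (a * b).
  apply: cvgMr_tmp; apply: cvgB; first exact: cvg_cst.
  have := @cvg_expr R d; rewrite ger0_norm ?(ltW d0)// => /(_ d1).
  by rewrite -cvg_shiftS.
rewrite subr0 mul1r in lim.
apply: cvgr_to_le lim _; apply: nearW => n.
have [w [wB wA]] := iter n.
exact: gabor_redundancy a0 b0 ltr01 wA wB.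
Qed.

End DensityTheorem.

(** * The Bessel bound from the Wiener norm *)

Section Walnut.
Context {R : realType}.
Local Notation mu := (@lebesgue_measure R).
Local Notation V := (@L2V R).
Implicit Types (u v w x y f : V) (a b : R).

Lemma ae_shift (P : R -> Prop) (c : R) :
  (\forall t \ae mu, P t) -> \forall t \ae mu, P (t - c).
Proof.
have ms : measurable_fun setT (fun t : R => t - c) by exact: measurable_funB.
move=> [N [mN N0 PN]]; exists [set t | N (t - c)]; split.
- by rewrite -[X in measurable X]setTI; exact: ms.
- by rewrite -[RHS]N0 -(lebesgue_measure_shift c mN).
- by move=> t /= h; exact: PN.
Qed.

Lemma ess_sup_cLnorm (F : R -> R[i]) :
  \forall t \ae mu, ((Normc.normc (F t))%:E <= cLnorm +oo F)%E.
Proof.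
have mT : (0 < mu setT)%E by rewrite -set_itvNyy lebesgue_measure_itv/= ltry.
have h := ess_sup_ge mu (abse \o (fun t => (Normc.normc (F t))%:E)).
rewrite /cLnorm unlock mT.
apply: (@filterS _ _ (ae_filter_ringOfSetsType mu) _ _ _ h) => t; apply: le_trans.
by rewrite lee_fin ler_norm.
Qed.

(** The term of index [- j] of the Wiener norm: the window translated by [- j a],
    seen on [[0, a[], is the window on the cell of index [j]. *)
Definition cell_sup a v (j : int) : \bar R :=
  cLnorm +oo%E (fun t => translate ((- j)%:~R * a) (cfun v) t *
    ((\1_(`[0, a[ : set R) t : R)%:C)%C).

Lemma wiener_cell_sup a v :
  (wiener_norm a (cfun v) = \esum_(j in [set: int]) cell_sup a v j)%E.
Proof.
by rewrite /wiener_norm (@reindex_esum _ _ _ setT setT (fun n : int => - n)).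
Qed.

Lemma normc_le_cell_sup a v : 0 < a -> \forall t \ae mu,
  ((Normc.normc (cfun v t))%:E <= cell_sup a v (Num.floor (t / a)))%E.
Proof.
move=> a0; have [s bs] := enum_int.
have h j : \forall t \ae mu, cell a j t ->
    ((Normc.normc (cfun v t))%:E <= cell_sup a v j)%E.
  have := ae_shift (j%:~R * a) (ess_sup_cLnorm (fun t =>
    translate ((- j)%:~R * a) (cfun v) t * ((\1_(`[0, a[ : set R) t : R)%:C)%C)).
  apply: (@filterS _ _ (ae_filter_ringOfSetsType mu)) => t + tj.
  apply: le_trans; rewrite lee_fin /translate mulrNz mulNr opprK subrK.
  rewrite indicE mem_set ?mulr1//=.
  have /cell_shift : cell a (0 + j) t by rewrite add0r.
  by rewrite /cell/= mul0r add0r mul1r.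
have := ae_foralln (fun k => h (s k)).
apply: (@filterS _ _ (ae_filter_ringOfSetsType mu)) => t ht.
have [s' sK s'K] := bs.
have := ht (s' (Num.floor (t / a))); rewrite s'K; apply.
exact/cellE.
Qed.

Lemma measurable_cellwise a (c : int -> R) : 0 < a ->
  measurable_fun setT (fun t : R => c (Num.floor (t / a))).
Proof.
move=> a0; have [s bs] := enum_int.
have cov : [set: R] = \bigcup_k cell a (s k).
  apply/seteqP; split => // t _; have [s' sK s'K] := bs.
  by exists (s' (Num.floor (t / a))) => //; apply/cellE.
rewrite cov; apply/measurable_fun_bigcup => k; first exact: measurable_cell.
apply: (eq_measurable_fun (cst (c (s k)))) => //.
by move=> t /[!inE] /(cellE _ _ a0) ->.
Qed.

Section Row.
Context {a b : R} (a0 : 0 < a) (b0 : 0 < b) (ab1 : a * b <= 1).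
Context {v : V} {c : int -> R} {W : R} (c0 : forall j, 0 <= c j) (W0 : 0 < W).
Context (vc : \forall t \ae mu, Normc.normc (cfun v t) <= c (Num.floor (t / a))).
Context (cW : (\esum_(j in [set: int]) (c j)%:E <= W%:E)%E).

Let energy f (j : int) : \bar R :=
  (\int[mu]_(t in cell a j) (sqmod (cfun f) t)%:E)%E.

Let energy_ge0 f j : (0 <= energy f j)%E.
Proof. by apply: integral_ge0 => t _; rewrite lee_fin sqmod_ge0. Qed.

Lemma energy_esum f : (\esum_(j in [set: int]) energy f j = (ip f f)%:E)%E.
Proof.
rewrite -int_sqmod_cfun (integral_cells a0)//.
- by apply/measurable_EFinP; exact: measurable_sqmod_cfun.
- by move=> t; rewrite lee_fin sqmod_ge0.
Qed.

(** The sum [C] on the left is the product of [f] with [p T_{na} v]. On the cell of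
    index [j + n] the factor [T_{na} v] is at most [c j], and since a cell is not
    longer than the period [1 / b] the energy of [p] there is at most [C / b]. With
    the weight [l = W / b] in Young's inequality the energies of [p] contribute [C]
    to a bound of [2 * C]. *)
Lemma gabor_row_cells f n (s : seq int) : uniq s ->
  ((\sum_(m <- s) absip2 f (gabor a b v (m, n)))%:E <=
   (W * b^-1)%:E * \esum_(j in [set: int]) ((c j)%:E * energy f (j + n)%R))%E.
Proof.
move=> us; have [K fK Kt] := gabor_row a b v f n s.
set p := (fun m => coef f (gabor a b v (m, n))) in Kt.
set C := \sum_(m <- s) _ in fK *.
have CE : \sum_(m <- s) Normc.normc (p m) ^+ 2 = C.
  by apply: eq_bigr => m _; rewrite normc_sq.
have bi : 0 < b^-1 by rewrite invr_gt0.
pose l := W * b^-1; have l0 : 0 < l by rewrite mulr_gt0.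
have li : 0 < l^-1 by rewrite invr_gt0.
pose M t := c (Num.floor (t / a)).
pose sp t := sqmod (trigsum b s p) t.
pose sf t := sqmod (cfun f) t.
have msp : measurable_fun setT sp by exact: measurable_sqmod_trigsum.
have msf : measurable_fun setT sf by exact: measurable_sqmod_cfun.
pose G t := (M (t - n%:~R * a) * (l * sf t + l^-1 * sp t))%:E : \bar R.
have G0 t : (0 <= G t)%E.
  by rewrite lee_fin mulr_ge0 ?c0// addr_ge0// mulr_ge0 ?sqmod_ge0 ?(ltW l0) ?(ltW li).
have mG : measurable_fun setT G.
  apply/measurable_EFinP/measurable_funM.
    by apply: measurable_translate; exact: measurable_cellwise.
  by apply: measurable_funD; apply: measurable_funM.
have h : ((2 * ip f K)%:E <= \int[mu]_t G t)%E.
  apply: ip_le_integral => //.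
  apply: (@filterS _ _ (ae_filter_ringOfSetsType mu) _ _ _ (ae_shift (n%:~R * a) vc)).
  move=> t ht; rewrite lee_fin.
  have -> : sqmod (cfun K) t = sp t * sqmod (cfun v) (t - n%:~R * a).
    rewrite -[RHS](sqmodM _ (fun t => cfun v (t - n%:~R * a))).
    by rewrite /sqmod Kt.
  rewrite -/(sf t) mulrA [X in Num.sqrt X]mulrC sqrtrM ?sqmod_ge0//.
  rewrite mulrCA ler_pM// ?sqrtr_ge0 ?mulr_ge0 ?sqrtr_ge0//.
  by apply: sqrt_amgm => //; exact: sqmod_ge0.
have hc j : (\int[mu]_(t in cell a (j + n)) G t <=
    l%:E * ((c j)%:E * energy f (j + n)%R) + (l^-1 * (b^-1 * C))%:E * (c j)%:E)%E.
  have lc0 : 0 <= l * c j by rewrite mulr_ge0 ?(ltW l0).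
  have lic0 : 0 <= l^-1 * c j by rewrite mulr_ge0 ?(ltW li).
  rewrite (_ : (\int[mu]_(t in _) _)%E = (\int[mu]_(t in cell a (j + n))
      ((l * c j)%:E * (sf t)%:E + (l^-1 * c j)%:E * (sp t)%:E))%E); last first.
    apply: eq_integral => t /[!inE] /cell_shift /(cellE _ _ a0) tj.
    by rewrite /G /M tj -!EFinM -EFinD; congr EFin; ring.
  rewrite ge0_integralD//; last 5 first.
  - exact: measurable_cell.
  - by move=> t _; rewrite -EFinM lee_fin mulr_ge0 ?sqmod_ge0.
  - by apply: measurable_funeM; apply/measurable_EFinP/measurable_funTS.
  - by move=> t _; rewrite -EFinM lee_fin mulr_ge0 ?sqmod_ge0.
  - by apply: measurable_funeM; apply/measurable_EFinP/measurable_funTS.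
  rewrite !ge0_integralZl_EFin//; last 6 first.
  - exact: measurable_cell.
  - by move=> t _; rewrite lee_fin sqmod_ge0.
  - by apply/measurable_EFinP/measurable_funTS.
  - exact: measurable_cell.
  - by move=> t _; rewrite lee_fin sqmod_ge0.
  - by apply/measurable_EFinP/measurable_funTS.
  apply: leeD; first by rewrite muleA -EFinM.
  rewrite -EFinM (_ : l^-1 * (b^-1 * C) * c j = l^-1 * c j * (b^-1 * C)); last by ring.
  rewrite [leRHS]EFinM lee_wpmul2l ?lee_fin ?mulr_ge0 ?(ltW li)//.
  rewrite -CE; apply: trigsum_integral_le => //.
  rewrite (intrD _ (j + n)) mulrDl mul1r lerD2l -[leRHS]mul1r.
  by rewrite ler_pdivlMr.
have h2 : ((2 * ip f K)%:E <= l%:E * (\esum_(j in [set: int])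
    ((c j)%:E * energy f (j + n)%R)) + C%:E)%E.
  apply: le_trans h _; rewrite (integral_cells a0)//.
  rewrite -(esum_shift _ n).
  apply: (@le_trans _ _ (\esum_(j in [set: int])
    (l%:E * ((c j)%:E * energy f (j + n)%R) +
     (l^-1 * (b^-1 * C))%:E * (c j)%:E))%E).
    by apply: le_esum => j _; exact: hc.
  have C0 : 0 <= C by rewrite sumr_ge0// => m _; exact: absip2_ge0.
  have q0 : 0 <= l^-1 * (b^-1 * C) by rewrite !mulr_ge0 ?(ltW li) ?(ltW bi).
  have [z bz] := enum_int.
  rewrite esumD; last 2 first.
  - by move=> j _; rewrite !mule_ge0 ?lee_fin ?(ltW l0) ?energy_ge0.
  - by move=> j _; rewrite mule_ge0 ?lee_fin.
  rewrite !(esumZl bz) ?(ltW l0)//; last first.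
  - by move=> j; rewrite mule_ge0 ?lee_fin ?energy_ge0.
  apply: leeD => //.
  apply: (@le_trans _ _ ((l^-1 * (b^-1 * C))%:E * W%:E)%E).
    by rewrite lee_wpmul2l ?lee_fin.
  rewrite -EFinM lee_fin /l le_eqVlt; apply/orP; left; apply/eqP.
  by field; rewrite !gt_eqF.
rewrite fK (_ : 2 * C = C + C) in h2; last by ring.
by rewrite EFinD leeD2rE in h2.
Qed.

Lemma gabor_bessel_cells : bessel (gabor a b v) (W ^+ 2 / b).
Proof.
move=> f.
have Wb0 : 0 <= W * b^-1 by rewrite mulr_ge0 ?invr_ge0 ?(ltW W0) ?(ltW b0).
have ce0 j n : (0 <= (c j)%:E * energy f (j + n)%R)%E.
  by rewrite mule_ge0 ?lee_fin ?energy_ge0.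
apply: (@le_trans _ _ (\esum_(n in [set: int]) ((W * b^-1)%:E *
    \esum_(j in [set: int]) ((c j)%:E * energy f (j + n)%R)))%E).
  apply: esum_pair_le => [i|n s us]; first by rewrite lee_fin absip2_ge0.
  by rewrite sumEFin gabor_row_cells.
have [z bz] := enum_int.
rewrite (esumZl bz)//; last by move=> n; exact: esum_ge0.
rewrite esum_swap//.
have -> : (\esum_(j in [set: int]) \esum_(n in [set: int])
    ((c j)%:E * energy f (j + n)%R) = (ip f f)%:E * \esum_(j in [set: int]) (c j)%:E)%E.
  rewrite -(esumZl bz)//; last exact: psd_ge0 psd_ip _.
  apply: eq_esum => j _; rewrite (esumZl bz)// muleC; congr (_ * _)%E.
  under eq_esum do rewrite addrC.
  by rewrite esum_shift energy_esum.
have f0 : 0 <= ip f f by exact: psd_ge0 psd_ip _.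
apply: (@le_trans _ _ ((W * b^-1)%:E * ((ip f f)%:E * W%:E))%E).
  by rewrite !lee_wpmul2l ?lee_fin.
by rewrite -!EFinM lee_fin le_eqVlt; apply/orP; left; apply/eqP; ring.
Qed.

End Row.

Theorem gabor_bessel_wiener a b v W : 0 < a -> 0 < b -> a * b <= 1 -> 0 < W ->
  (wiener_norm a (cfun v) <= W%:E)%E -> bessel (gabor a b v) (W ^+ 2 / b).
Proof.
move=> a0 b0 ab1 W0; rewrite wiener_cell_sup => hW.
have s0 j : (0 <= cell_sup a v j)%E by exact: cLnorm_ge0.
have sfin j : cell_sup a v j \is a fin_num.
  rewrite ge0_fin_numE//; apply: le_lt_trans (ltry W); apply: le_trans hW.
  have := esum_ge_seq (l := [:: j]) s0 isT.
  by rewrite big_seq1.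
apply: (gabor_bessel_cells a0 b0 ab1 (c := fun j => fine (cell_sup a v j))) => //.
- by move=> j; exact: fine_ge0.
- apply: (@filterS _ _ (ae_filter_ringOfSetsType mu) _ _ _ (normc_le_cell_sup v a0)).
  by move=> t; rewrite -{1}(fineK (sfin _)) lee_fin.
- by under eq_esum do rewrite fineK//.
Qed.

End Walnut.

(** * Perturbation of Gabor frames and Riesz bases *)

Section Perturbation.
Context {R : realType}.
Local Notation V := (@L2V R).
Implicit Types (u v w x y f : V) (a b : R) (e : int * int -> V).

Lemma bessel_closed e B : (forall eps, 0 < eps -> bessel e (B + eps)) -> bessel e B.
Proof.
move=> h x; apply/lee_addgt0Pr => d d0.
have q0 : 0 < ip x x + 1 by rewrite ltr_wpDl// (psd_ge0 psd_ip).
apply: le_trans (h (d / (ip x x + 1)) _ x) _; first by rewrite divr_gt0.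
rewrite -EFinD lee_fin mulrDl lerD2l mulrAC ler_pdivrMr// ler_pM2l//.
by rewrite lerDl.
Qed.

Lemma bessel_le e B C : B <= C -> bessel e B -> bessel e C.
Proof.
move=> BC h x; apply: le_trans (h x) _.
by rewrite lee_fin ler_wpM2r// (psd_ge0 psd_ip).
Qed.

Lemma bessel_subC e1 e2 B :
  bessel (fun i => e1 i - e2 i) B -> bessel (fun i => e2 i - e1 i) B.
Proof.
move=> h x; apply: le_trans (h x); rewrite le_eqVlt; apply/orP; left; apply/eqP.
by apply: eq_esum => i _; rewrite -absip2N opprB.
Qed.

Lemma gaborB a b u v i : gabor a b (u - v) i = gabor a b u i - gabor a b v i.
Proof. by rewrite /gabor -scaleN1r shiftopD shiftopZ scaleN1r. Qed.

Lemma gabor_bessel_sub a b u v r : 0 < a -> 0 < b -> a * b <= 1 -> 0 <= r ->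
  (wiener_norm a (cfun (u - v)) <= (Num.sqrt (b * r / 4))%:E)%E ->
  bessel (fun i => gabor a b u i - gabor a b v i) r.
Proof.
move=> a0 b0 ab1 r0 hW; apply: bessel_closed => d d0.
have rd : 0 < r + d by rewrite ltr_wpDl.
have W0 : 0 < b * (r + d) / 4 by rewrite divr_gt0// mulr_gt0.
have {}hW : (wiener_norm a (cfun (u - v)) <= (Num.sqrt (b * (r + d) / 4))%:E)%E.
  apply: le_trans hW _; rewrite lee_fin ler_wsqrtr// ler_pM2r ?invr_gt0//.
  by rewrite ler_pM2l// lerDl ltW.
have sW : 0 < Num.sqrt (b * (r + d) / 4) by rewrite sqrtr_gt0.
have := gabor_bessel_wiener a0 b0 ab1 sW hW.
rewrite sqr_sqrtr ?(ltW W0)// (_ : b * (r + d) / 4 / b = (r + d) / 4); last first.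
  by field; rewrite gt_eqF.
rewrite (_ : gabor a b (u - v) = fun i => gabor a b u i - gabor a b v i); last first.
  by apply/funext => i; exact: gaborB.
by apply: bessel_le; lra.
Qed.

Lemma gabor_riesz_perturb a b u v A B r C D : 0 < A -> 0 < B -> 0 < C -> 0 < D ->
  0 <= r -> r < A ->
  frame_below (gabor a b u) A -> bessel (gabor a b u) B ->
  frame_below (gabor a b v) C -> bessel (gabor a b v) D ->
  bessel (fun i => gabor a b u i - gabor a b v i) r ->
  is_riesz_basis (fun i => cfun (gabor a b u i)) ->
  is_riesz_basis (fun i => cfun (gabor a b v i)).
Proof.
move=> A0 B0 C0 D0 r0 rA uA uB vC vD uv [ub _].
have low := riesz_lower_bound A0 B0 uA uB ub.
have [A' A'0 vlow] := lower_bound_perturb r0 rA uv low.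
split; first exact: basis_of_lower_bound C0 D0 A'0 vC vD vlow.
have norm i : cLnorm 2%:E (cfun (gabor a b v i)) = (Num.sqrt (ip v v))%:E.
  by rewrite cLnorm2_cfun ip_shiftop.
exists (Num.sqrt (ip v v)), (Num.sqrt (ip v v)); split; last first.
  by move=> i; rewrite norm lexx.
rewrite sqrtr_gt0; have [s bs] := enum_int2.
have := vlow s 1%N (fun=> 1) _ bs erefl.
rewrite !big_ord1 Normc.normc1 expr1n mulr1.
have -> : cscal 1 (gabor a b v (s 0%N)) = gabor a b v (s 0%N).
  by rewrite /cscal scale1r scale0r addr0.
by rewrite ip_shiftop; exact: lt_le_trans.
Qed.

End Perturbation.

Theorem theorem3p2 (R : realType) (g : R -> R[i]) (a b A B : R)
    (hg : L2 g) (ha : 0 < a) (hb : 0 < b) (gframe : is_WH_frame g a b A B)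
    (h : R -> R[i]) (hh : L2 h) (r : R) (hr0 : 0 <= r) (hrA : r < A)
    (hgh : (wiener_norm a (fun t => g t - h t)%R
            <= (Num.sqrt (b * r / 4))%:E)%E) :
  is_WH_frame h a b
    (A * (1 - Num.sqrt (r / A)) ^+ 2) (B * (1 + Num.sqrt (r / B)) ^+ 2) /\
  (is_WH_riesz_basis g a b -> is_WH_riesz_basis h a b).
Proof.
move: gframe hgh; rewrite /is_WH_frame /is_WH_riesz_basis.
rewrite -(toL2K hg) -(toL2K hh); move: (toL2 g) (toL2 h) => u v.
rewrite !WH_gabor => /is_frameP[A0 B0 uA uB] hW.
have ab1 := gabor_density ha hb A0 B0 uA uB.
have uv : bessel (fun i => gabor a b u i - gabor a b v i) r.
  exact: gabor_bessel_sub ha hb ab1 hr0 hW.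
have sq (C : R) : 0 < C -> C * Num.sqrt (r / C) ^+ 2 = r.
  by move=> C0; rewrite sqr_sqrtr ?divr_ge0 ?(ltW C0)// mulrC divfK ?gt_eqF.
have tA : Num.sqrt (r / A) < 1.
  by rewrite -sqrtr1 ltr_sqrt// ltr_pdivrMr// mul1r.
have vu := bessel_subC uv.
have vuB : bessel (fun i => gabor a b v i - gabor a b u i) (B * Num.sqrt (r / B) ^+ 2).
  by rewrite (sq B B0).
have vuA : bessel (fun i => gabor a b v i - gabor a b u i) (A * Num.sqrt (r / A) ^+ 2).
  by rewrite (sq A A0).
have vB := bessel_perturb (sqrtr_ge0 _) uB vuB.
have vA := frame_below_perturb (sqrtr_ge0 _) tA uA vB vuA.
have C0 : 0 < A * (1 - Num.sqrt (r / A)) ^+ 2.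
  by rewrite mulr_gt0 ?exprn_gt0 ?subr_gt0.
have D0 : 0 < B * (1 + Num.sqrt (r / B)) ^+ 2.
  by rewrite mulr_gt0 ?exprn_gt0 ?ltr_wpDr ?sqrtr_ge0.
split; first exact/is_frameP.
exact: gabor_riesz_perturb A0 B0 C0 D0 hr0 hrA uA uB vA vB uv.
Qed.
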